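(* Let $(W,Y)$ and $(W',Y')$ be random vectors on a common probability space satisfying the following. (I) $\mathbb{E}W=0$, $\operatorname{Var}(W)=1$; $\mathbb{E}Y=0$, $\operatorname{Var}(Y)=\sigma_Y^2$; $W$ and $Y$ are uncorrelated; and $(W,Y,W',Y')\overset{d}{=}(W',Y',W,Y)$. (II) $Y$ takes values in $\zeta+\mathbb{Z}$ for some $\zeta\in[0,1)$, $\Delta Y:=Y'-Y\in\{-1,0,1\}$ almost surely, and $M_{0,\pm}(W,Y)=Q+R_{0,\pm}$, where $Q=\lambda\sigma_Y^2$ for some $\lambda\in(0,1)$ and $R_{0,\pm}$ are random variables. (III) $M_{1,\pm}(W,Y)=-\lambda\left(\tfrac12\psi W+R_{1,\pm}\right)$ for some $\psi>0$ and random variables $R_{1,\pm}$. (IV) $M_{2,\pm}(W,Y)=\lambda(\psi+R_{2,\pm})$ for random variables $R_{2,\pm}$. Let $k$ be such that $p_k:=\mathbb{P}(Y=k)>0$ and $p_{k-1}:=\mathbb{P}(Y=k-1)>0$, and let $r_k:=p_{k-1}/p_k$. Then, with $Z$ standard normal, $$d_W\big((W\mid Y=k),Z\big)\le\frac1\psi\widehat A_k+\sqrt{\frac{1}{2\pi\psi^2}}\widehat B_k+(1+r_k)\Big(\frac{1}{2Q}\widehat C_k+\frac1{2Q}\widehat D_k+\frac{2}{3\lambda\psi}\widehat E_k\Big),$$ where $\widehat A_k=\mathbb{E}(|R_{1,-}|\mid Y=k)+r_k\,\mathbb{E}(|R_{1,+}|\mid Y=k-1)$, $\widehat B_k=\mathbb{E}(|R_{2,-}|\mid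 Y=k)+r_k\,\mathbb{E}(|R_{2,+}|\mid Y=k-1)$, $\widehat C_k=\mathbb{E}\big((|W|+\mathbb{E}|Z|)(|R_{0,+}|+|R_{0,-}|)\mid Y\in\{k-1,k\}\big)$, $\widehat D_k=\mathbb{E}(|\Delta W|\mid Y\in\{k-1,k\})$, $\widehat E_k=\mathbb{E}(|\Delta W|^3\mid Y\in\{k-1,k\})$.
   Context: $\Delta W:=W'-W$. For $\ell\ge0$, $M_{\ell,\pm}(W,Y):=\mathbb{E}\big((\Delta W)^\ell\,\mathbf{1}_{\{\Delta Y=\pm1\}}\mid W,Y\big)$. For a random variable $V$ and event $B$ of positive probability, $d_W((V\mid B),Z):=\sup_h|\mathbb{E}(h(V)\mid B)-\mathbb{E}h(Z)|$ over all $1$-Lipschitz $h:\mathbb{R}\to\mathbb{R}$. *)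

(* Defs.v *)
From HB Require Import structures.
From mathcomp Require Import all_boot all_order all_algebra.
From mathcomp Require Import all_classical all_reals all_analysis.
Set Implicit Arguments. Unset Strict Implicit. Unset Printing Implicit Defensive.
Import Order.TTheory GRing.Theory Num.Theory.
Local Open Scope classical_set_scope.
Local Open Scope ring_scope.

Section defs.
Context {d : measure_display} {T : measurableType d} {R : realType}.
Variable P : probability T R.

(** Conditional expectation on an event: E(f | A) = (int_A f dP) / P(A)
    (used only for events of positive probability). *)
Definition condE (A : set T) (f : T -> \bar R) : \bar R :=
  ((\int[P]_(x in A) f x) * ((fine (P A))^-1)%:E)%E.

(** [g] is a version of the conditional expectation E(X | W, Y), seen as a
    Borel function of the pair (W, Y): X is integrable, g is measurable and
    E(X 1_{(W,Y) in B}) = E(g(W,Y) 1_{(W,Y) in B}) for all Borel B of R^2. *)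
Definition is_condexp_pair (W Y X : T -> R) (g : R * R -> R) : Prop :=
  measurable_fun setT g /\ P.-integrable setT (EFin \o X) /\
  forall B : set (R * R), measurable B ->
    (\int[P]_(x in (fun x => (W x, Y x)) @^-1` B) (X x)%:E =
     \int[P]_(x in (fun x => (W x, Y x)) @^-1` B) (g (W x, Y x))%:E)%E.

Definition dW_cond_normal (A : set T) (V : T -> R) : \bar R :=
  ereal_sup [set e | exists h : R -> R,
     (forall x y, `|h x - h y| <= `|x - y|) /\
     e = `| condE A (fun x => (h (V x))%:E)
            - \int[normal_prob 0 1]_y (h y)%:E |%E ].
End defs.

Definition EabsZ {R : realType} : \bar R :=
  (\int[@normal_prob R 0 1]_y (`|y|)%:E)%E.

(* Main.v *)
(** For a 1-Lipschitz [h] let [f] solve the Stein equation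
    [f' x - x f x = h x - E h(Z) =: g x].  Exchangeability makes
    [(W' - W) (f W + f W')] antisymmetric on the jumps between the levels [k]
    and [k - 1]; expanding [f W'] at [W] and conditioning on [(W, Y)] turns this
    into a bound on [E(g W; Y = k) + E(g W; Y = k - 1)].  Exchangeability
    applied to [g] itself, on the same jumps, bounds
    [E(g W; Y = k) - E(g W; Y = k - 1)].  The sum of the two is the claim.

    The constants come from [|f| <= 1], [|f'| <= sqrt (2 / pi)] and
    [f'] 2-Lipschitz.  Up to the density [phi x], each of [f x], [f' x] and
    [(x f)'(x)] is a combination with known signs of the integrals of
    [h - h x] against the normal law on either side of [x], so it is largest for
    [h t = |t - x|] up to signs on the two sides.  For [f'] this leaves an
    inequality in one variable, [momL_momR_le], obtained from a maximum
    principle. *)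

Require Import Defs.
From HB Require Import structures.
From mathcomp Require Import all_boot all_order all_algebra.
From mathcomp Require Import all_classical all_reals all_analysis.
From mathcomp Require Import measurable_realfun ring lra.
Set Implicit Arguments.
Unset Strict Implicit.
Unset Printing Implicit Defensive.

Import Order.TTheory GRing.Theory Num.Theory.
Import numFieldNormedType.Exports.
Local Open Scope classical_set_scope.
Local Open Scope ring_scope.

(** The level [k] alone is not closed under exchange: a jump from [k] to [k - 1], read backwards, is
    a jump from [k - 1] to [k]. The mean of [g W] on [Y = k] is therefore half the sum plus half the
    difference of the means on the two levels, and these halves produce 1/(2Q) and turn sqrt (2 /
    pi) into sqrt (1 / (2 pi)). That last coefficient leaves no slack, so the bound on [f'] has to
    be the sharp one. The cubic term has slack: the argument gives 1/2 where 2/3 is claimed. The sum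
    of the two means sees Stein's operator because (W' - W)(f W + f W') is 2 (W' - W) f W + (W' -
    W)^2 f' W up to a cubic error. The 2 cancels the 1/2 in (III), so both moments carry the factor
    lambda psi and leave f' W - W f W. The test function is only Lipschitz, so [f'] need not be
    differentiable, and its Lipschitz constant takes the place of a bound on a second derivative.
    The cubic error may have infinite mean; the right side is then infinite. The factor 1 + r_k only
    changes the conditioning: (1 + r_k) / P(Y in {k - 1, k}) = 1 / P(Y = k). *)

Section real_calculus.
Context {R : realType}.
Implicit Types f df : R -> R.

(** * Consequences of the mean value theorem, and a maximum principle *)

Lemma derive_continuous f df : (forall x : R, is_derive x 1 f (df x)) -> continuous f.
Proof.
by move=> fdf x; apply/differentiable_continuous/derivable1_diffP; have [] := fdf x.
Qed.

Lemma mean_value f df (a b : R) : (forall x : R, is_derive x 1 f (df x)) -> a < b ->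
  exists2 c, a < c < b & f b - f a = df c * (b - a).
Proof.
move=> fdf ab.
have H : forall x, x \in `]a, b[ -> is_derive x 1 f (df x) by move=> x _; exact: fdf.
have [|c /[!in_itv]/= ? ?] := MVT ab H.
  apply: continuous_subspaceT; exact: derive_continuous fdf.
by exists c.
Qed.

Lemma le_of_derive_ge0 f df (a b : R) : (forall x : R, is_derive x 1 f (df x)) ->
  a <= b -> (forall x, a < x < b -> 0 <= df x) -> f a <= f b.
Proof.
move=> fdf; rewrite le_eqVlt => /predU1P[->//|ab df0].
have [c cab e] := mean_value fdf ab.
by rewrite -subr_ge0 e mulr_ge0 ?df0// subr_ge0 ltW.
Qed.

Lemma lt_of_derive_gt0 f df (a b : R) : (forall x : R, is_derive x 1 f (df x)) ->
  a < b -> (forall x, a < x < b -> 0 < df x) -> f a < f b.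
Proof.
move=> fdf ab df0.
have [c cab e] := mean_value fdf ab.
by rewrite -subr_gt0 e mulr_gt0 ?df0// subr_gt0.
Qed.

(** The case [L = 0] doubles as the constancy criterion by which the Gaussian primitives are
    identified. *)
Lemma lipschitz_of_derive f df (L : R) : (forall x : R, is_derive x 1 f (df x)) ->
  (forall x, `|df x| <= L) -> forall x y, `|f x - f y| <= L * `|x - y|.
Proof.
move=> fdf dfL.
have H a b : a < b -> `|f b - f a| <= L * `|b - a|.
  move=> ab; have [c _ ->] := mean_value fdf ab.
  by rewrite normrM ler_wpM2r.
move=> x y; have [xy|yx|->] := ltgtP x y; last by rewrite !subrr normr0 mulr0.
  by rewrite distrC (distrC x); exact: H.
exact: H.
Qed.

(** Convexity from a monotone derivative. It is applied to functions whose derivative need not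
    itself be differentiable, where no second-derivative test is available. *)
Lemma tangent_below f df (x y : R) : (forall x : R, is_derive x 1 f (df x)) ->
  {homo df : x y / x <= y} -> f y + df y * (x - y) <= f x.
Proof.
move=> fdf ndf; rewrite -lerBrDl.
have [xy|yx|->] := ltgtP x y; last by rewrite !subrr mulr0.
  have [c /andP[xc cy] e] := mean_value fdf xy.
  have := ndf _ _ (ltW cy).
  have -> : f x - f y = - (f y - f x) by rewrite opprB.
  by rewrite e -mulrN opprB ler_nM2r// subr_lt0.
have [c /andP[yc cx] e] := mean_value fdf yx.
have := ndf _ _ (ltW yc).
by rewrite e ler_pM2r// subr_gt0.
Qed.

(* At a positive maximum [x0] of [u] one has [p x0 = 0], yet [p] increases
   where [u > 0], so [u] would keep increasing to the right of [x0]. *)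
Lemma max_principle (u p q dp : R -> R) :
  (forall x : R, is_derive x 1 u (q x * p x)) -> (forall x, 0 < q x) ->
  (forall x : R, is_derive x 1 p (dp x)) ->
  (forall x, 0 <= x -> 0 < u x -> 0 < dp x) ->
  u 0 <= 0 ->
  (forall e, 0 < e -> exists M, forall x, M <= x -> u x <= e) ->
  forall x, 0 <= x -> u x <= 0.
Proof.
move=> du q0 dup dp0 u0 ulim x1 x1_ge0; rewrite leNgt; apply/negP => ux1.
have [M HM] := ulim (u x1 / 2) (divr_gt0 ux1 (ltr0n _ 2)).
(* At [N] the value of [u] is at most [u x1 / 2], so the maximum over [0, N] is not attained at the
   right end; [u 0 <= 0] excludes the left end. *)
pose N := Num.max M x1 + 1.
have x1N : x1 <= N by rewrite /N ler_wpDr// le_max lexx orbT.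
have N0 : 0 <= N by exact: le_trans x1N.
have cu := derive_continuous du.
have [|x0] := @EVT_max R u 0 N N0; first exact: continuous_subspaceT.
rewrite in_itv/= => /andP[x00 x0N] umax.
have ux0 : 0 < u x0.
  by apply: (lt_le_trans ux1); apply: umax; rewrite in_itv/= x1_ge0.
have x0_gt0 : 0 < x0.
  rewrite lt_neqAle x00 andbT; apply/eqP => x0E.
  by move: ux0; rewrite -x0E ltNge u0.
have x0_ltN : x0 < N.
  rewrite lt_neqAle x0N andbT; apply/eqP => x0E.
  have : u x1 <= u x0 by apply: umax; rewrite in_itv/= x1_ge0.
  have : u x0 <= u x1 / 2.
    by rewrite x0E; apply: HM; rewrite /N ler_wpDr// le_max lexx.
  by move: ux1; lra.
have pE0 : p x0 = 0.
  have : is_derive x0 1 u 0.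
    apply: (@derive1_at_max _ u 0 N x0 N0).
    - by move=> t _; have [] := du t.
    - by rewrite in_itv/= x0_gt0.
    - by move=> t tN; apply: umax; exact: subset_itv_oo_cc tN.
  move=> [_ d0]; have [_ d1] := du x0; move: d1; rewrite d0 => /eqP.
  by rewrite eq_sym mulf_eq0 gt_eqF//= => /eqP.
have [e e0 He] : exists2 e, 0 < e & forall x, x0 < x < x0 + e -> 0 < u x.
  have /cvgrPdist_lt/(_ _ ux0) := cu x0.
  move=> /nbhs_ballP[e /= e0 He]; exists e => // x /andP[xx0 xe].
  have /He : ball x0 e x by rewrite /ball/= distrC gtr0_norm ?subr_gt0// ltrBlDl.
  by rewrite ltr_norml => /andP[_]; rewrite ltrBlDr ltrDl.
pose y := Num.min (x0 + e / 2) N.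
have x0y : x0 < y by rewrite /y lt_min x0_ltN andbT ltrDl divr_gt0.
have ye : y < x0 + e.
  rewrite /y gt_min ltrD2l; apply/orP; left; by move: e0; lra.
have : u x0 < u y.
  apply: (lt_of_derive_gt0 du x0y) => x /andP[x0x xy].
  rewrite mulr_gt0// -pE0; apply: (lt_of_derive_gt0 dup x0x) => z /andP[x0z zx].
  apply: dp0; first exact: ltW (lt_trans x0_gt0 x0z).
  by apply: He; rewrite x0z/= (lt_trans zx)// (lt_trans xy).
apply/negP; rewrite -leNgt; apply: umax.
by rewrite in_itv/= (le_trans x00 (ltW x0y)) /y ge_min lexx orbT.
Qed.

End real_calculus.

(** * Gaussian density *)

Section gaussian_density.
Context {R : realType}.
Local Notation mu := (@lebesgue_measure R).

Definition phi : R -> R := normal_pdf 0 1.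
Definition Phi (x : R) : R := \int[mu]_(t in `]-oo, x]) phi t.

Lemma phi0E : phi 0 = (Num.sqrt (2 * pi))^-1.
Proof.
rewrite /phi normal_pdfE ?oner_eq0// /normal_fun subr0 expr0n/= oppr0 mul0r expR0.
by rewrite mulr1 /normal_peak expr1n mul1r -mulr_natl.
Qed.

Lemma phiE x : phi x = phi 0 * expR (- (x ^+ 2) / 2).
Proof.
rewrite /phi !normal_pdfE ?oner_eq0// /normal_fun !subr0 expr0n/= oppr0 mul0r expR0.
by rewrite mulr1 expr1n.
Qed.

Lemma phi0_gt0 : 0 < phi 0.
Proof. by rewrite phi0E invr_gt0 sqrtr_gt0 mulr_gt0// pi_gt0. Qed.

Lemma phi_gt0 x : 0 < phi x.
Proof. by rewrite phiE mulr_gt0 ?phi0_gt0 ?expR_gt0. Qed.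

Lemma phi_ge0 x : 0 <= phi x. Proof. exact/ltW/phi_gt0. Qed.

Lemma phiN x : phi (- x) = phi x.
Proof. by rewrite phiE sqrrN -phiE. Qed.

Lemma phi_le x : phi x <= phi 0.
Proof.
rewrite phiE ler_piMr ?phi_ge0// -[leRHS]expR0 ler_expR mulNr oppr_le0.
by rewrite divr_ge0 ?sqr_ge0.
Qed.

#[global] Instance is_derive_phi (x : R) : is_derive x 1 phi (- x * phi x).
Proof.
rewrite (_ : phi = fun y => phi 0 * expR (- (y ^+ 2) / 2)); last first.
  by apply/funext => y; rewrite phiE.
apply: is_derive_eq.
by rewrite !scaler0 /GRing.scale/= !mulr1; field.
Qed.

Lemma continuous_phi : continuous phi.
Proof. exact: derive_continuous is_derive_phi. Qed.

(* [exp y >= (1 + y/2)^2 >= y^2/4] with [y = x^2/2]. *)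
Lemma phi_tail x : 0 < x -> x ^+ 3 * phi x <= 16 * phi 0 / x.
Proof.
move=> x0; rewrite ler_pdivlMr// -mulrA [phi x * x]mulrC mulrA -exprSr.
rewrite [phi x]phiE mulrCA [leRHS]mulrC ler_pM2l ?phi0_gt0//.
rewrite mulNr expRN -ler_pdivlMr ?invr_gt0 ?expR_gt0// invrK.
have H : 1 + x ^+ 2 / 4 <= expR (x ^+ 2 / 4) by exact: expR_ge1Dx.
have -> : x ^+ 2 / 2 = x ^+ 2 / 4 + x ^+ 2 / 4 by field.
rewrite expRD.
have H0 : 0 <= x ^+ 2 by exact: sqr_ge0.
have : (1 + x ^+ 2 / 4) * (1 + x ^+ 2 / 4) <= expR (x ^+ 2 / 4) * expR (x ^+ 2 / 4).
  by apply: ler_pM => //; rewrite addr_ge0// divr_ge0.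
have -> : x ^+ 4 = x ^+ 2 * x ^+ 2 by rewrite -exprD.
by move: (x ^+ 2) H0 => y; nra.
Qed.

(** One decay estimate for all the tails below: beyond [M >= 1] the cube dominates the lower powers
    of [x]. *)
Lemma phi_small e : 0 < e -> exists2 M : R, 1 <= M & forall x, M <= x -> x ^+ 3 * phi x <= e.
Proof.
move=> e0; exists (Num.max 1 (16 * phi 0 / e)); first by rewrite le_max lexx.
move=> x; rewrite ge_max => /andP[x1 xe].
have x0 : 0 < x by exact: lt_le_trans x1.
by apply: (le_trans (phi_tail x0)); rewrite ler_pdivrMr// [e * x]mulrC -ler_pdivrMr.
Qed.

Lemma phi_cvg0 : phi x @[x --> +oo] --> 0.
Proof.
apply/cvgrPdist_le => e e0; have [M M1 HM] := phi_small e0.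
exists M; split; first exact: num_real.
move=> x /= Mx; rewrite sub0r normrN ger0_norm ?phi_ge0//.
apply: le_trans (HM _ (ltW Mx)); rewrite ler_peMl ?phi_ge0// exprn_ege1//.
exact: le_trans M1 (ltW Mx).
Qed.

Lemma integrable_phi : mu.-integrable [set: R] (EFin \o phi).
Proof. exact: integrable_normal_pdf. Qed.

Lemma integral_phi : (\int[mu]_x (phi x)%:E)%E = 1%E.
Proof. exact: integral_normal_pdf. Qed.

Lemma integral_idphi0y : (\int[mu]_(x in `[0%R, +oo[) (x * phi x)%:E)%E = (phi 0)%:E.
Proof.
have dN (x : R) : is_derive x 1 (- phi) (x * phi x).
  by apply: is_derive_eq; rewrite mulNr opprK.
rewrite (@ge0_continuous_FTC2y R _ (- phi) 0 0).
- by rewrite sub0e /= opprK.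
- by move=> x x0; rewrite mulr_ge0// phi_ge0.
- apply: continuous_subspaceT => x.
  by apply: cvgM; [exact: cvg_id|exact: continuous_phi].
- by rewrite -oppr0; apply: cvgN; exact: phi_cvg0.
- by move=> x _; have [] := dN x.
- apply: cvg_at_right_filter; exact: (derive_continuous dN).
- by move=> x _; rewrite derive1E; have [_ ->] := dN x.
Qed.

Lemma continuous_idphi : continuous (fun x : R => x * phi x).
Proof. by move=> x; apply: cvgM; [exact: cvg_id|exact: continuous_phi]. Qed.

Lemma integrable_idphi : mu.-integrable [set: R] (EFin \o (fun x => x * phi x)).
Proof.
apply/integrableP; split.
  by apply/measurable_EFinP; exact: continuous_measurable_fun continuous_idphi.
rewrite (_ : (fun x => _) = (fun x => (`|x * phi x|)%:E))//.
rewrite ge0_symfun_integralT//.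
- rewrite -set_itvcy (_ : integral _ _ _ = (phi 0)%:E) ?ltry//.
  rewrite -integral_idphi0y; apply: eq_integral => x.
  by rewrite inE/= in_itv/= andbT => x0; rewrite ger0_norm// mulr_ge0// phi_ge0.
- by move=> x; apply: cvg_norm; exact: continuous_idphi.
- by move=> x /=; rewrite phiN mulNr normrN.
Qed.

Lemma is_derive_primitive (g : R -> R) (x : R) : continuous g ->
  mu.-integrable [set: R] (EFin \o g) ->
  is_derive x 1 (fun x : R => \int[mu]_(t in `]-oo, x]) g t) (g x).
Proof.
move=> cg ig.
have xx1 : x < x + 1 by rewrite ltrDl.
have igx : mu.-integrable [set` Interval -oo%O (BRight (x + 1))] (EFin \o g).
  exact: integrableS ig.
have [dF eF] := continuous_FTC1 xx1 igx (ltNyr _) (cg x).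
by split => //; rewrite -derive1E.
Qed.

#[global] Instance is_derive_Phi (x : R) : is_derive x 1 Phi (phi x).
Proof. exact: is_derive_primitive continuous_phi integrable_phi. Qed.

(** The integral plus [phi] has derivative zero, so one value suffices. At 0 it comes by reflection
    from the right half-line, where the integrand is nonnegative. *)
Lemma integral_idphi x : \int[mu]_(t in `]-oo, x]) (t * phi t) = - phi x.
Proof.
pose F (x : R) := \int[mu]_(t in `]-oo, x]) (t * phi t).
have dF (y : R) : is_derive y 1 (F \+ phi) 0.
  have ? := is_derive_primitive y continuous_idphi integrable_idphi.
  by apply: is_derive_eq; rewrite mulNr subrr.
have F0 : F 0 = - phi 0.
  rewrite /F /Rintegral.
  have := @ge0_integration_by_substitutionNy R (fun t => - (t * phi t)) 0.
  rewrite oppr0 => H.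
  have : (\int[mu]_(x in `]-oo, 0%R]) (- (x * phi x))%:E)%E = (phi 0)%:E.
    rewrite H.
    - rewrite -integral_idphi0y; apply: eq_integral => t _ /=.
      by rewrite phiN mulNr opprK.
    - apply: continuous_subspaceT => t; apply: cvgN; exact: continuous_idphi.
    - move=> t; rewrite in_itv/= => t0; rewrite -mulNr mulr_ge0 ?phi_ge0//.
      by rewrite oppr_ge0 ltW.
  have -> : (\int[mu]_(x in `]-oo, 0%R]) (- (x * phi x))%:E =
             - \int[mu]_(x in `]-oo, 0%R]) (x * phi x)%:E)%E.
    rewrite -integralN//=.
    by apply: integrable_add_def => //; exact: integrableS integrable_idphi.
  by move=> /(congr1 oppe); rewrite oppeK => ->.
have C y : (F \+ phi) y = 0.
  have -> : 0 = (F \+ phi) 0 by rewrite /= F0 addNr.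
  apply/eqP; rewrite -subr_eq0 -normr_eq0 eq_le normr_ge0 andbT.
  have := @lipschitz_of_derive R _ _ 0 dF _ y 0; rewrite mul0r; apply => z.
  by rewrite normr0.
by apply/eqP; rewrite -addr_eq0; apply/eqP/C.
Qed.

End gaussian_density.

(** * Integrability of real-valued combinations *)

Section real_integrable.
Context d (T : measurableType d) (R : realType).
Variables (mu : {measure set T -> \bar R}) (D : set T).
Hypothesis mD : measurable D.
Implicit Types f g : T -> R.

Lemma integrable_scale (a : R) f : mu.-integrable D (EFin \o f) ->
  mu.-integrable D (EFin \o (fun x => a * f x)).
Proof.
move=> fi; rewrite (_ : EFin \o _ = (fun x => a%:E * (EFin \o f) x)%E)//.
exact: integrableZl.
Qed.

Lemma integrable_add f g : mu.-integrable D (EFin \o f) ->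
  mu.-integrable D (EFin \o g) -> mu.-integrable D (EFin \o (fun x => f x + g x)).
Proof. exact: integrableD. Qed.

Lemma integrable_sub f g : mu.-integrable D (EFin \o f) ->
  mu.-integrable D (EFin \o g) -> mu.-integrable D (EFin \o (fun x => f x - g x)).
Proof. exact: integrableB. Qed.

Lemma integrable_le f g : measurable_fun D f -> mu.-integrable D (EFin \o g) ->
  (forall x, D x -> `|f x| <= g x) -> mu.-integrable D (EFin \o f).
Proof.
move=> mf ig fg; apply: (le_integrable mD _ _ ig); first exact/measurable_EFinP.
by move=> x Dx; rewrite lee_fin (le_trans (fg x Dx))// ler_norm.
Qed.

Lemma integrable_normr f : mu.-integrable D (EFin \o f) ->
  mu.-integrable D (EFin \o (fun x => `|f x|)).
Proof. exact: integrable_norm. Qed.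

End real_integrable.

(** * The normal distribution function and truncated first moments *)

Section mills_ratio.
Context {R : realType}.
Local Notation mu := (@lebesgue_measure R).
Implicit Type x : R.

Lemma Rintegral_split (g : R -> R) x : mu.-integrable [set: R] (EFin \o g) ->
  \int[mu]_(t in `]-oo, x]) g t + \int[mu]_(t in `]x, +oo[) g t = \int[mu]_t g t.
Proof.
move=> ig; rewrite -Rintegral_setU//.
- by rewrite -itv_bndbnd_setU// set_itvE.
- by apply: integrableS ig => //; exact: measurableU.
- apply/disj_setPS => t [] /=; rewrite !in_itv/= andbT => tx xt.
  by move: (le_lt_trans tx xt); rewrite ltxx.
Qed.

Lemma Rintegral_phi : \int[mu]_t phi t = 1 :> R.
Proof. by rewrite /Rintegral integral_phi. Qed.

Lemma Phi_right x : \int[mu]_(t in `]x, +oo[) phi t = 1 - Phi x.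
Proof. by rewrite -Rintegral_phi -(Rintegral_split x integrable_phi) addrC addKr. Qed.

Lemma Phi_ge0 x : 0 <= Phi x.
Proof. by apply: Rintegral_ge0 => t _; exact: phi_ge0. Qed.

Lemma Phi_le1 x : Phi x <= 1.
Proof.
by rewrite -subr_ge0 -Phi_right; apply: Rintegral_ge0 => t _; exact: phi_ge0.
Qed.

Lemma Phi0 : Phi 0 = 2^-1 :> R.
Proof.
suff : Phi 0 = 1 - Phi 0 :> R by lra.
rewrite -Phi_right /Phi /Rintegral; congr fine.
have := @ge0_integration_by_substitutionNy R phi 0; rewrite oppr0 => ->.
- rewrite -integral_itv_obnd_cbnd//; last first.
    apply/measurable_EFinP/measurable_funTS; apply: continuous_measurable_fun.
    by move=> t; apply: cvg_comp; [exact: opp_continuous|exact: continuous_phi].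
  by apply: eq_integral => t _ /=; rewrite phiN.
- apply: continuous_subspaceT; exact: continuous_phi.
- by move=> t _; exact: phi_ge0.
Qed.

Lemma PhiN x : Phi (- x) = 1 - Phi x.
Proof.
have dF (y : R) : is_derive y 1 (fun y => Phi (- y) + Phi y) 0.
  have ? : is_derive y 1 (fun y => Phi (- y)) (- phi (- y)).
    have -> : (fun y => Phi (- y)) = Phi \o -%R by [].
    have ? : is_derive (- y) 1 Phi (phi (- y)) by exact: is_derive_Phi.
    by apply: is_derive_eq; rewrite /GRing.scale/=; ring.
  by apply: is_derive_eq; rewrite phiN addNr.
have := @lipschitz_of_derive R _ _ 0 dF _ x 0; rewrite mul0r oppr0 Phi0.
move=> H; have : `|Phi (- x) + Phi x - (2^-1 + 2^-1)| <= 0.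
  by apply: H => z; rewrite normr0.
rewrite normr_le0 subr_eq0 => /eqP.
by clear; lra.
Qed.

Lemma Rintegral_idphi : \int[mu]_t (t * phi t) = 0 :> R.
Proof.
rewrite -(Rintegral_split 0 integrable_idphi) integral_idphi.
rewrite /Rintegral integral_itv_obnd_cbnd ?integral_idphi0y/= ?addNr//.
apply/measurable_EFinP; apply: measurable_funTS.
exact: continuous_measurable_fun continuous_idphi.
Qed.

(* [E (x - Z)^+] and [E (Z - x)^+] in closed form. *)
Definition momL x := x * Phi x + phi x.
Definition momR x := phi x - x * (1 - Phi x).

Lemma integrable_affine_phi (a b : R) :
  mu.-integrable [set: R] (EFin \o (fun t => (a + b * t) * phi t)).
Proof.
rewrite (_ : (fun _ => _) = fun t => a * phi t + b * (t * phi t)); last first.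
  by apply/funext => t; ring.
by apply: integrable_add => //; apply: integrable_scale => //;
  [exact: integrable_phi|exact: integrable_idphi].
Qed.

Lemma Rintegral_affine_phi (a b : R) (A : set R) : measurable A ->
  \int[mu]_(t in A) ((a + b * t) * phi t) =
  a * \int[mu]_(t in A) phi t + b * \int[mu]_(t in A) (t * phi t).
Proof.
move=> mA.
have i1 : mu.-integrable A (EFin \o phi) by exact: integrableS integrable_phi.
have i2 : mu.-integrable A (EFin \o (fun t => t * phi t)).
  exact: integrableS integrable_idphi.
rewrite -!RintegralZl// -RintegralD//.
- by apply: eq_Rintegral => t _; ring.
- exact: integrable_scale i1.
- exact: integrable_scale i2.
Qed.

Lemma momLE x : momL x = \int[mu]_(t in `]-oo, x]) ((x - t) * phi t).
Proof.
under eq_Rintegral do rewrite -[_ - _]/(_ + _) -mulN1r.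
by rewrite Rintegral_affine_phi// integral_idphi mulN1r opprK.
Qed.

Lemma momRE x : momR x = \int[mu]_(t in `]x, +oo[) ((t - x) * phi t).
Proof.
have := Rintegral_split x integrable_idphi; rewrite Rintegral_idphi integral_idphi.
move=> H; under eq_Rintegral do rewrite addrC -[X in _ + X]mul1r.
by rewrite Rintegral_affine_phi// Phi_right /momR; move: H; lra.
Qed.

Lemma momL_ge0 x : 0 <= momL x.
Proof.
rewrite momLE; apply: Rintegral_ge0 => t /=; rewrite in_itv/= => tx.
by rewrite mulr_ge0 ?subr_ge0 ?phi_ge0.
Qed.

Lemma momRN x : momR (- x) = momL x.
Proof. by rewrite /momR /momL phiN PhiN; ring. Qed.

Lemma momR_ge0 x : 0 <= momR x.
Proof. by rewrite -[x]opprK momRN momL_ge0. Qed.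

Lemma le_exp3 x : 1 <= x -> [/\ 1 <= x ^+ 3, x <= x ^+ 3 & x ^+ 2 <= x ^+ 3].
Proof.
by move=> x1; rewrite -[in X in [/\ _, X <= _ & _]](expr1 x) !ler_weXn2l// exprn_ege1.
Qed.

(** The lower bound on the Mills ratio. The difference of the two sides has derivative
    [2 * momR x >= 0], hence increases, and far out it is below any positive number. The bound fixes
    the sign of a coefficient in the derivative of [x * f x]. *)
Lemma mills_lower x : x * phi x <= (1 + x ^+ 2) * (1 - Phi x).
Proof.
pose B x : R := x * phi x - (1 + x ^+ 2) * (1 - Phi x).
have dB (y : R) : is_derive y 1 B (2 * momR y).
  by apply: is_derive_eq; rewrite /momR /GRing.scale/=; ring.
have ndB y : x <= y -> B x <= B y.
  move=> xy; apply: (le_of_derive_ge0 dB xy) => t _.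
  by rewrite mulr_ge0 ?momR_ge0.
rewrite -subr_le0 -/(B x); apply/ler_addgt0Pl => e e0; rewrite addr0.
have [M M1 HM] := phi_small e0.
pose y := Num.max x M; have My : M <= y by rewrite le_max lexx orbT.
apply: (le_trans (ndB y _)); first by rewrite le_max lexx.
have [_ yy _] := le_exp3 (le_trans M1 My).
apply: le_trans (HM _ My); rewrite /B.
have : y * phi y <= y ^+ 3 * phi y by rewrite ler_wpM2r// phi_ge0.
have : 0 <= (1 + y ^+ 2) * (1 - Phi y).
  by rewrite mulr_ge0 ?subr_ge0 ?Phi_le1// addr_ge0// sqr_ge0.
lra.
Qed.

Lemma mills_lowerN x : 0 <= (1 + x ^+ 2) * Phi x + x * phi x.
Proof. by have := mills_lower (- x); rewrite phiN PhiN sqrrN; lra. Qed.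

End mills_ratio.

(** * The one-variable inequality behind the bound on the derivative *)

Section moment_product.
Context {R : realType}.
Implicit Type x : R.

(** [D] is odd and [E = 1 - D^2] is even, so [K] and [V] are odd and vanish at 0, which is the
    boundary condition for the maximum principle. Up to the factor [4 * phi], [V] is the derivative
    of [momL * momR / phi]; [K] is the source term in the equation satisfied by [V]. *)
Let D x : R := 2 * Phi x - 1.
Let E x : R := 4 * Phi x * (1 - Phi x).
Let K x : R := 2 * x * E x - 8 * phi x * D x.
Let V x : R := 4 * phi x * D x * (1 + x ^+ 2) + 4 * x * phi x ^+ 2 -
  E x * (2 * x + x ^+ 3).

Let is_derive_phiV x : is_derive x 1 (fun x => (phi x)^-1) (x / phi x).
Proof.
have phi_neq0 : phi x != 0 by rewrite gt_eqF// phi_gt0.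
apply: is_derive_eq; rewrite /GRing.scale/=; field; exact: phi_neq0.
Qed.

Let D_ge0 x : 0 <= x -> 0 <= D x.
Proof.
move=> x0; have : Phi 0 <= Phi x.
  by apply: (le_of_derive_ge0 (@is_derive_Phi R) x0) => t _; exact: phi_ge0.
by rewrite Phi0 /D; lra.
Qed.

Let E_le x : E x <= 4 * (1 - Phi x).
Proof.
rewrite /E -mulrA ler_pM2l// ler_piMl ?Phi_le1// subr_ge0.
exact: Phi_le1.
Qed.

(** Writing [K' = phi * p] absorbs the drift term: [K'' + x K' = phi * p'] because [phi' = - x phi].
    The equation for [K] then gives [p' = (K + 16 x phi^2) / phi], which is positive wherever [K]
    is. *)
Let K_le0 x : 0 <= x -> K x <= 0.
Proof.
move: x; apply: (@max_principle R K (fun x => 2 * E x / phi x - 16 * phi x) phi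
  (fun x => (K x + 16 * x * phi x ^+ 2) / phi x)).
- move=> x; have phi_neq0 : phi x != 0 by rewrite gt_eqF// phi_gt0.
  apply: is_derive_eq; rewrite /E /D /GRing.scale/=; field; exact: phi_neq0.
- exact: phi_gt0.
- move=> x; have phi_neq0 : phi x != 0 by rewrite gt_eqF// phi_gt0.
  apply: is_derive_eq; rewrite /K /E /D /GRing.scale/=; field; exact: phi_neq0.
- move=> x x0 Kx0; rewrite divr_gt0 ?phi_gt0// ltr_pwDl// mulr_ge0 ?sqr_ge0//.
  by rewrite mulr_ge0.
- by rewrite /K /D Phi0; lra.
(* The 8 comes from [K x <= 2 x E x <= 8 x (1 - Phi x) <= 8 phi x]; the last inequality is
   [momR x >= 0]. *)
- move=> e e0; have [M M1 HM] := @phi_small R (e / 8) (divr_gt0 e0 (ltr0n _ 8)).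
  exists M => x Mx; have x1 : 1 <= x := le_trans M1 Mx.
  have x0 : 0 <= x := le_trans ler01 x1.
  have [h1 _ _] := le_exp3 x1.
  have := HM _ Mx.
  have : phi x <= x ^+ 3 * phi x by rewrite ler_peMl// phi_ge0.
  have : 0 <= phi x * D x by rewrite mulr_ge0 ?phi_ge0 ?D_ge0.
  have : x * E x <= x * (4 * (1 - Phi x)) by rewrite ler_wpM2l// E_le.
  have := momR_ge0 x; rewrite /momR /K.
  lra.
Qed.

(** The same substitution gives [p' = (3 V - K) / phi], and [K <= 0] makes this positive wherever
    [V] is. *)
Let V_le0 x : 0 <= x -> V x <= 0.
Proof.
move: x; apply: (@max_principle R V
  (fun x => 12 * x * D x + 12 * phi x - E x * (2 + 3 * x ^+ 2) / phi x) phi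
  (fun x => (3 * V x - K x) / phi x)).
- move=> x; have phi_neq0 : phi x != 0 by rewrite gt_eqF// phi_gt0.
  apply: is_derive_eq; rewrite /E /D /GRing.scale/=; field; exact: phi_neq0.
- exact: phi_gt0.
- move=> x; have phi_neq0 : phi x != 0 by rewrite gt_eqF// phi_gt0.
  apply: is_derive_eq; rewrite /V /K /E /D /GRing.scale/=; field; exact: phi_neq0.
- move=> x x0 Vx0; rewrite divr_gt0 ?phi_gt0//.
  by have := K_le0 x0; move: Vx0; lra.
- by rewrite /V /D Phi0; lra.
- move=> e e0.
  (* In units of [x^3 * phi x], the 8 bounds [4 phi D (1 + x^2)] and [4 * phi 0] bounds [4 x phi^2];
     the [E] term enters [V] with a favourable sign. *)
  have c0 : 0 < 8 + 4 * phi 0 :> R by rewrite addr_gt0// mulr_gt0// phi0_gt0.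
  have [M M1 HM] := @phi_small R (e / (8 + 4 * phi 0)) (divr_gt0 e0 c0).
  exists M => x Mx; have x1 : 1 <= x := le_trans M1 Mx.
  have x0 : 0 <= x := le_trans ler01 x1.
  have [h1 h2 h3] := le_exp3 x1.
  have := HM _ Mx; rewrite ler_pdivlMr//; apply: le_trans.
  have E0 : 0 <= E x * (2 * x + x ^+ 3).
    by rewrite mulr_ge0 ?addr_ge0 ?mulr_ge0 ?Phi_ge0 ?subr_ge0 ?Phi_le1// exprn_ge0.
  have p0 := phi_ge0 x.
  have H1 : phi x * D x * (1 + x ^+ 2) <= phi x * (2 * x ^+ 3).
    rewrite -mulrA ler_wpM2l//.
    have : D x * (1 + x ^+ 2) <= 1 * (1 + x ^+ 2).
      rewrite ler_wpM2r ?addr_ge0 ?sqr_ge0// /D.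
      by have := Phi_le1 x; lra.
    by move: h1 h3; lra.
  have H2 : x * phi x ^+ 2 <= x ^+ 3 * phi x * phi 0.
    by rewrite expr2 mulrA ler_pM ?mulr_ge0// ?ler_wpM2r// phi_le.
  by move: H1 H2 E0; rewrite /V; lra.
Qed.

(* Equality holds at [x = 0]; for [x >= 0] the quotient
   [momL x * momR x / phi x] has derivative [V x / (4 * phi x)], and
   [V'' + x V' - 3 V = - K >= 0] and [K'' + x K' - K = 16 x phi^2 >= 0]. *)
Lemma momL_momR_le x : momL x * momR x <= phi 0 * phi x.
Proof.
wlog x0 : x / 0 <= x.
  move=> H; have [/H//|x0] := leP 0 x.
  have e : momL (- x) = momR x by rewrite -momRN opprK.
  have := H (- x); rewrite momRN e phiN mulrC; apply.
  by rewrite oppr_ge0 ltW.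
pose G x : R := - (momL x * momR x / phi x).
have dG (y : R) : is_derive y 1 G (- (V y / (4 * phi y))).
  have phi_neq0 : phi y != 0 by rewrite gt_eqF// phi_gt0.
  rewrite /G /momL /momR.
  apply: is_derive_eq; rewrite /V /E /D /GRing.scale/=; field; exact: phi_neq0.
have : G 0 <= G x.
  apply: (le_of_derive_ge0 dG x0) => t /andP[t0 _].
  rewrite -mulNr divr_ge0 ?oppr_ge0 ?V_le0 ?mulr_ge0 ?phi_ge0//; exact: ltW.
rewrite /G lerN2 ler_pdivrMr ?phi_gt0//; move/le_trans; apply.
rewrite ler_wpM2r ?phi_ge0// /momL /momR !mul0r subr0 add0r mulfK//.
by rewrite gt_eqF// phi_gt0.
Qed.

End moment_product.

(** * Stein's equation *)

Section stein_equation.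
Context {R : realType}.
Local Notation mu := (@lebesgue_measure R).
Variable h : R -> R.
Hypothesis h_lip : forall x y, `|h x - h y| <= `|x - y|.
Implicit Type x : R.

Lemma lip1_continuous : continuous h.
Proof.
move=> x; apply/cvgrPdist_le => e e0; near=> y.
apply: (le_trans (h_lip _ _)).
near: y; exact: cvgr_dist_le.
Unshelve. all: by end_near. Qed.

Lemma integrable_lip1_phi : mu.-integrable [set: R] (EFin \o (fun t => h t * phi t)).
Proof.
apply: (@integrable_le _ _ R mu setT measurableT _
  (fun t : R => `|h 0| * phi t + `|t * phi t|)).
- apply: continuous_measurable_fun => x.
  by apply: cvgM; [exact: lip1_continuous|exact: continuous_phi].
- apply: integrable_add => //.
    by apply: integrable_scale => //; exact: integrable_phi.
  by apply: integrable_normr => //; exact: integrable_idphi.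
- move=> t _; rewrite !normrM (ger0_norm (phi_ge0 t)) -mulrDl.
  rewrite ler_wpM2r ?phi_ge0//.
  have := h_lip t 0; rewrite subr0; have := ler_normD (h 0) (h t - h 0).
  by rewrite addrC subrK; lra.
Qed.

Definition gauss_mean : R := \int[mu]_t (h t * phi t).
Let F x : R := \int[mu]_(t in `]-oo, x]) ((h t - gauss_mean) * phi t).
Let f x : R := F x * (phi x)^-1.
(** Read off from Stein's equation, which thereby holds by definition; that this is the derivative
    of [f] is what remains to be proved. *)
Let df x : R := h x - gauss_mean + x * f x.
(** Centring at [h x] instead of the mean lets the Lipschitz condition bound [IL] and [IR] by [momL]
    and [momR]. Since [phi] has mass 1, the mean itself is recovered from [h x], [IL] and [IR]. *)
Let IL x : R := \int[mu]_(t in `]-oo, x]) ((h t - h x) * phi t).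
Let IR x : R := \int[mu]_(t in `]x, +oo[) ((h t - h x) * phi t).

Let integrable_centered (c : R) (A : set R) : measurable A ->
  mu.-integrable A (EFin \o (fun t => (h t - c) * phi t)).
Proof.
move=> mA; apply: (@integrableS _ _ _ mu setT) => //.
rewrite (_ : (fun t => _) = fun t => h t * phi t - c * phi t); last first.
  by apply/funext => t; rewrite mulrBl.
apply: integrable_sub => //; first exact: integrable_lip1_phi.
by apply: integrable_scale => //; exact: integrable_phi.
Qed.

Let Rintegral_centered (c : R) (A : set R) : measurable A ->
  \int[mu]_(t in A) ((h t - c) * phi t) =
  \int[mu]_(t in A) (h t * phi t) - c * \int[mu]_(t in A) phi t.
Proof.
move=> mA.
have i1 : mu.-integrable A (EFin \o (fun t => h t * phi t)).
  exact: integrableS integrable_lip1_phi.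
have i2 : mu.-integrable A (EFin \o phi) by exact: integrableS integrable_phi.
rewrite -RintegralZl// -RintegralB//; last exact: integrable_scale i2.
by apply: eq_Rintegral => t _; ring.
Qed.

Let IL_le x : `|IL x| <= momL x.
Proof.
rewrite momLE; apply: (le_trans (le_normr_Rintegral _ _)) => //.
  exact: integrable_centered.
apply: le_Rintegral => //.
- by apply: integrable_normr => //; exact: integrable_centered.
- rewrite (_ : (fun t => _) = fun t => (x + (- 1) * t) * phi t); last first.
    by apply/funext => t; rewrite mulN1r.
  by apply: (@integrableS _ _ _ mu setT) => //; exact: integrable_affine_phi.
- move=> t /=; rewrite in_itv/= => tx.
  rewrite normrM (ger0_norm (phi_ge0 t)) ler_wpM2r ?phi_ge0//.
  by rewrite (le_trans (h_lip _ _))// distrC ger0_norm// subr_ge0.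
Qed.

Let IR_le x : `|IR x| <= momR x.
Proof.
rewrite momRE; apply: (le_trans (le_normr_Rintegral _ _)) => //.
  exact: integrable_centered.
apply: le_Rintegral => //.
- by apply: integrable_normr => //; exact: integrable_centered.
- rewrite (_ : (fun t => _) = fun t => (- x + 1 * t) * phi t); last first.
    by apply/funext => t; rewrite mul1r addrC.
  by apply: (@integrableS _ _ _ mu setT) => //; exact: integrable_affine_phi.
- move=> t /=; rewrite in_itv/= andbT => tx.
  rewrite normrM (ger0_norm (phi_ge0 t)) ler_wpM2r ?phi_ge0//.
  by rewrite (le_trans (h_lip _ _))// ger0_norm// subr_ge0 ltW.
Qed.

Let hIE x : h x - gauss_mean = - (IL x + IR x).
Proof.
rewrite /gauss_mean -(Rintegral_split x integrable_lip1_phi) /IL /IR.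
by rewrite !Rintegral_centered// Phi_right -/(Phi x); ring.
Qed.

Let FE x : F x = (1 - Phi x) * IL x - Phi x * IR x.
Proof.
rewrite /F Rintegral_centered// /gauss_mean.
rewrite -(Rintegral_split x integrable_lip1_phi) /IL /IR.
by rewrite !Rintegral_centered// Phi_right -/(Phi x); ring.
Qed.

Let le_combination (a b x : R) : 0 <= a -> 0 <= b ->
  `|a * IL x - b * IR x| <= a * momL x + b * momR x.
Proof.
move=> a0 b0; rewrite (le_trans (ler_normB _ _))// !normrM (ger0_norm a0) (ger0_norm b0).
by rewrite lerD// ler_wpM2l.
Qed.

Let is_derive_f x : is_derive x 1 f (df x).
Proof.
have phi_neq0 : phi x != 0 by rewrite gt_eqF// phi_gt0.
have ? : is_derive x 1 F ((h x - gauss_mean) * phi x).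
  apply: (@is_derive_primitive R (fun t => (h t - gauss_mean) * phi t)).
    move=> t; apply: cvgM; last exact: continuous_phi.
    by apply: cvgB; [exact: lip1_continuous|exact: cvg_cst].
  exact: integrable_centered.
apply: is_derive_eq; rewrite /df /f /GRing.scale/=; field; exact: phi_neq0.
Qed.

Let f_le1 x : `|f x| <= 1.
Proof.
rewrite normrM normfV (gtr0_norm (phi_gt0 x)) ler_pdivrMr ?phi_gt0// mul1r FE.
rewrite (le_trans (le_combination _ _ _))// ?Phi_ge0 ?subr_ge0 ?Phi_le1//.
(* [(1 - Phi x) * momL x + Phi x * momR x] is exactly [phi x]. *)
by rewrite /momL /momR; lra.
Qed.

(** In [phi * df] the coefficients of [IL] and [IR] are, up to sign, [momR] and [momL]. The bound is
    thus [2 * momL * momR / phi], and [2 * phi 0] is sqrt (2 / pi). *)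
Let df_le x : `|df x| <= 2 * phi 0.
Proof.
have p0 := phi_gt0 x.
have -> : df x = - (momR x * IL x - (- momL x) * IR x) / phi x.
  rewrite /df /f hIE FE /momL /momR; field; by rewrite gt_eqF.
rewrite normrM normfV (gtr0_norm p0) ler_pdivrMr// normrN.
rewrite (le_trans (ler_normB _ _))// !normrM normrN.
rewrite (ger0_norm (momR_ge0 x)) (ger0_norm (momL_ge0 x)).
apply: (@le_trans _ _ (momR x * momL x + momL x * momR x)).
  by rewrite lerD// ler_wpM2l ?momR_ge0 ?momL_ge0.
by have := momL_momR_le x; lra.
Qed.

Let idf_lip x y : `|x * f x - y * f y| <= `|x - y|.
Proof.
rewrite -[leRHS]mul1r.
apply: (@lipschitz_of_derive R (fun x => x * f x) (fun x => f x + x * df x)) => z.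
  by have ? := is_derive_f z; apply: is_derive_eq; rewrite /GRing.scale/=; ring.
have p0 := phi_gt0 z.
have -> : f z + z * df z = (((1 + z ^+ 2) * (1 - Phi z) - z * phi z) * IL z -
    ((1 + z ^+ 2) * Phi z + z * phi z) * IR z) / phi z.
  rewrite /df /f hIE FE; field; by rewrite gt_eqF.
rewrite normrM normfV (gtr0_norm p0) ler_pdivrMr// mul1r.
rewrite (le_trans (le_combination _ _ _))//.
- by rewrite subr_ge0 mills_lower.
- exact: mills_lowerN.
(* Since [momL z - momR z = z], the combination equals [(1 + z^2) phi z - z^2 phi z = phi z]. *)
- by rewrite /momL /momR; lra.
Qed.

Let df_lip x y : x <= y -> `|df y - df x| <= 2 * (y - x).
Proof.
move=> xy.
(* The constant 2 is 1 + 1: [h] and [x * f x] are each 1-Lipschitz. *)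
have -> : df y - df x = (h y - h x) + (y * f y - x * f x) by rewrite /df; ring.
rewrite (le_trans (ler_normD _ _))// mulr_natl mulr2n lerD//.
  by rewrite (le_trans (h_lip _ _))// ger0_norm// subr_ge0.
by rewrite (le_trans (idf_lip _ _))// ger0_norm// subr_ge0.
Qed.

(** As [df] is 2-Lipschitz, [z^2 - s * f z] has a monotone derivative for [s = 1] and [s = -1],
    hence lies above its tangents; the tangent of [z^2] leaves the error [(x - y)^2]. *)
Let taylor2 x y : `|f x - f y - df y * (x - y)| <= (x - y) ^+ 2.
Proof.
have H (s : R) : `|s| = 1 -> s * (f x - f y - df y * (x - y)) <= (x - y) ^+ 2.
  move=> s1.
  have dg (z : R) : is_derive z 1 (fun z => z ^+ 2 - s * f z) (2 * z - s * df z).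
    by have ? := is_derive_f z; apply: is_derive_eq; rewrite /GRing.scale/=; ring.
  have ndg : {homo (fun z => 2 * z - s * df z) : a b / a <= b}.
    move=> a b ab; rewrite -subr_ge0.
    have := df_lip ab.
    have : s * (df b - df a) <= `|df b - df a|.
      by rewrite (le_trans (ler_norm _))// normrM s1 mul1r.
    by lra.
  by have := tangent_below x y dg ndg; rewrite /=; lra.
rewrite ler_norml; apply/andP; split.
  by have := H (-1); rewrite normrN1 mulN1r => /(_ erefl); lra.
by have := H 1; rewrite normr1 mul1r; apply.
Qed.

Lemma stein_solution : exists f df : R -> R,
  [/\ forall x : R, is_derive x 1 f (df x),
      forall x, df x - x * f x = h x - gauss_mean,
      forall x, `|f x| <= 1,
      forall x, `|df x| <= 2 * phi 0 &
      forall x y, `|f x - f y - df y * (x - y)| <= (x - y) ^+ 2].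
Proof.
exists f, df; split => //.
by move=> x; rewrite /df addrK.
Qed.

Lemma integrable_normid_phi :
  mu.-integrable [set: R] (EFin \o (fun t => `|t| * phi t)).
Proof.
rewrite (_ : (fun t => _) = fun t => `|t * phi t|); last first.
  by apply/funext => t; rewrite normrM (ger0_norm (phi_ge0 t)).
by apply: integrable_normr => //; exact: integrable_idphi.
Qed.

(** Averaging [|h t - h x| <= |x| + |t|] over the normal law; this is the origin of the weight
    [|W| + E|Z|] in the third error term. *)
Lemma gauss_mean_dist x :
  `|h x - gauss_mean| <= `|x| + \int[mu]_t (`|t| * phi t).
Proof.
rewrite distrC.
have -> : gauss_mean - h x = \int[mu]_t ((h t - h x) * phi t).
  by rewrite Rintegral_centered// Rintegral_phi mulr1.
apply: (le_trans (le_normr_Rintegral _ _)) => //; first exact: integrable_centered.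
have -> : `|x| + \int[mu]_t (`|t| * phi t) =
    \int[mu]_t (`|x| * phi t + `|t| * phi t).
  rewrite RintegralD// ?RintegralZl ?Rintegral_phi ?mulr1//.
  - exact: integrable_phi.
  - by apply: integrable_scale => //; exact: integrable_phi.
  - exact: integrable_normid_phi.
apply: le_Rintegral => //.
- by apply: integrable_normr => //; exact: integrable_centered.
- apply: integrable_add => //; last exact: integrable_normid_phi.
  by apply: integrable_scale => //; exact: integrable_phi.
- move=> t _; rewrite normrM (ger0_norm (phi_ge0 t)) -mulrDl ler_wpM2r ?phi_ge0//.
  by rewrite (le_trans (h_lip _ _))// [leRHS]addrC ler_normB.
Qed.

End stein_equation.

(** * Conditional expectations and exchangeability *)

Section integral_of_composition.
Context d d' (X : measurableType d) (Y : measurableType d') (R : realType).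
Variables (m : {measure set X -> \bar R}) (p : X -> Y) (rho : X -> R).
Hypotheses (mp : measurable_fun setT p) (mrho : measurable_fun setT rho).
Hypothesis rho0 : forall x, 0 <= rho x.
Local Open Scope ereal_scope.
Import HBNNSimple.

Let mpre (B : set Y) : measurable B -> measurable (p @^-1` B).
Proof. by move=> mB; rewrite -[_ @^-1` _]setTI; exact: mp. Qed.

Lemma integral_comp_nnsfun (g : {nnsfun Y >-> R}) :
  \int[m]_x (g (p x) * rho x)%:E =
  \sum_(k \in range g) k%:E * \int[m]_(x in p @^-1` (g @^-1` [set k])) (rho x)%:E.
Proof.
have mind k : measurable_fun setT
    (fun x => k%:E * ((\1_(g @^-1` [set k]) (p x))%:E * (rho x)%:E)).
  apply: measurable_funeM; apply: emeasurable_funM; last exact/measurable_EFinP.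
  apply/measurable_EFinP; apply: measurableT_comp mp; exact: measurable_indic.
transitivity (\int[m]_x \sum_(k \in range g)
    k%:E * ((\1_(g @^-1` [set k]) (p x))%:E * (rho x)%:E)).
  apply: eq_integral => x _.
  rewrite EFinM fimfunE -fsumEFin// ge0_mule_fsuml.
    by apply: eq_fsbigr => k _; rewrite EFinM muleA.
  by move=> k; rewrite EFinM; exact: nnfun_muleindic_ge0.
rewrite ge0_integral_fsum//; last first.
  by move=> k x _; rewrite muleA mule_ge0 ?nnfun_muleindic_ge0// lee_fin.
apply: eq_fsbigr => k; rewrite inE => -[y _ <-].
rewrite ge0_integralZl//.
- rewrite [in RHS]integral_mkcond; congr (_ * _); apply: eq_integral => x _.
  rewrite patchE; case: ifPn => [/set_mem/= e|].
    by rewrite indicE mem_set// mul1e.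
  by move=> /negP e; rewrite indicE memNset ?mul0e// => e'; apply: e; rewrite inE.
- apply: emeasurable_funM; last exact/measurable_EFinP.
  apply/measurable_EFinP; apply: measurableT_comp mp; exact: measurable_indic.
- by move=> x _; rewrite mule_ge0 ?lee_fin.
- by rewrite lee_fin.
Qed.

Lemma integral_comp_approx (u : Y -> R) (mu : measurable_fun setT (EFin \o u)) :
  (forall y, 0 <= u y)%R ->
  \int[m]_x (u (p x) * rho x)%:E =
  limn (fun n => \int[m]_x (nnsfun_approx measurableT mu n (p x) * rho x)%:E).
Proof.
move=> u0; rewrite -monotone_convergence//.
- apply: eq_integral => x _; apply/esym/cvg_lim => //; rewrite EFinM.
  under eq_fun do rewrite EFinM.
  apply: cvgeZr => //; apply: (@cvg_nnsfun_approx _ _ _ _ _ _ mu) => // y _.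
  by rewrite lee_fin.
- move=> n; apply/measurable_EFinP; apply: measurable_funM => //.
  by apply: measurableT_comp mp; exact: measurable_funP.
- by move=> n x _; rewrite lee_fin mulr_ge0.
- move=> x _ a b ab; rewrite lee_fin ler_wpM2r//.
  exact/lefP/nd_nnsfun_approx.
Qed.

End integral_of_composition.

Section le_transfer.
Context d1 d2 d' (X1 : measurableType d1) (X2 : measurableType d2)
  (Y : measurableType d') (R : realType).
Variables (m1 : {measure set X1 -> \bar R}) (m2 : {measure set X2 -> \bar R}).
Variables (p1 : X1 -> Y) (p2 : X2 -> Y) (rho1 : X1 -> R) (rho2 : X2 -> R).
Hypotheses (mp1 : measurable_fun setT p1) (mp2 : measurable_fun setT p2).
Hypotheses (mrho1 : measurable_fun setT rho1) (mrho2 : measurable_fun setT rho2).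
Hypotheses (rho1_ge0 : forall x, 0 <= rho1 x) (rho2_ge0 : forall x, 0 <= rho2 x).
Local Open Scope ereal_scope.
Import HBNNSimple.

(** A comparison on preimages extends to simple functions by summing over their values and then to
    monotone limits. The form with an inequality serves the domination of [|g (W, Y)|] by [|X|];
    equality follows from two uses. *)
Lemma le_transfer (u : Y -> R) :
  (forall B : set Y, measurable B ->
    \int[m1]_(x in p1 @^-1` B) (rho1 x)%:E <= \int[m2]_(x in p2 @^-1` B) (rho2 x)%:E) ->
  measurable_fun setT u -> (forall y, 0 <= u y)%R ->
  \int[m1]_x (u (p1 x) * rho1 x)%:E <= \int[m2]_x (u (p2 x) * rho2 x)%:E.
Proof.
move=> rho12 mu u0.
have mu' : measurable_fun setT (EFin \o u) by exact/measurable_EFinP.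
have nd d (X : measurableType d) (m : {measure set X -> \bar R}) (p : X -> Y)
    (rho : X -> R) : measurable_fun setT p -> measurable_fun setT rho ->
    (forall x, 0 <= rho x)%R -> nondecreasing_seq (fun n =>
      \int[m]_x (nnsfun_approx measurableT mu' n (p x) * rho x)%:E).
  move=> mp mrho r0 a b ab; apply: ge0_le_integral => //.
  - by move=> x _; rewrite lee_fin mulr_ge0.
  - apply/measurable_EFinP; apply: measurable_funM => //.
    by apply: measurableT_comp mp; exact: measurable_funP.
  - apply/measurable_EFinP; apply: measurable_funM => //.
    by apply: measurableT_comp mp; exact: measurable_funP.
  - move=> x _; rewrite lee_fin ler_wpM2r//; exact/lefP/nd_nnsfun_approx.
rewrite (integral_comp_approx m1 mp1 mrho1 rho1_ge0 mu')//.
rewrite (integral_comp_approx m2 mp2 mrho2 rho2_ge0 mu')//.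
apply: lee_lim.
- by apply: ereal_nondecreasing_is_cvgn; exact: nd.
- by apply: ereal_nondecreasing_is_cvgn; exact: nd.
apply: nearW => n; rewrite !integral_comp_nnsfun//; apply: lee_fsum => // k /= [y _ yk].
by apply: lee_wpmul2l; [rewrite lee_fin -yk|exact: rho12].
Qed.

End le_transfer.

Section transfer.
Context d1 d2 d' (X1 : measurableType d1) (X2 : measurableType d2)
  (Y : measurableType d') (R : realType).
Variables (m1 : {measure set X1 -> \bar R}) (m2 : {measure set X2 -> \bar R}).
Variables (p1 : X1 -> Y) (p2 : X2 -> Y) (rho1 : X1 -> R) (rho2 : X2 -> R).
Hypotheses (mp1 : measurable_fun setT p1) (mp2 : measurable_fun setT p2).
Hypotheses (mrho1 : measurable_fun setT rho1) (mrho2 : measurable_fun setT rho2).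
Hypotheses (rho1_ge0 : forall x, 0 <= rho1 x) (rho2_ge0 : forall x, 0 <= rho2 x).
Hypothesis rho12 : forall B : set Y, measurable B ->
  (\int[m1]_(x in p1 @^-1` B) (rho1 x)%:E = \int[m2]_(x in p2 @^-1` B) (rho2 x)%:E)%E.
Local Open Scope ereal_scope.

Let ge0_transfer (u : Y -> R) : measurable_fun setT u -> (forall y, 0 <= u y)%R ->
  \int[m1]_x (u (p1 x) * rho1 x)%:E = \int[m2]_x (u (p2 x) * rho2 x)%:E.
Proof.
move=> mu u0; apply/eqP; rewrite eq_le; apply/andP; split.
  by apply: le_transfer => // B mB; rewrite rho12.
by apply: le_transfer => // B mB; rewrite rho12.
Qed.

(** The densities are nonnegative, so the positive and negative parts of [u * rho] come from those
    of [u] and transfer separately. The two sources and densities cover three uses: the normal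
    density, conditional expectations and exchangeability. *)
Lemma transfer (u : Y -> R) : measurable_fun setT u ->
  \int[m1]_x (u (p1 x) * rho1 x)%:E = \int[m2]_x (u (p2 x) * rho2 x)%:E.
Proof.
move=> mu; rewrite integralE [RHS]integralE.
have pE X (p : X -> Y) (rho : X -> R) : (forall x, 0 <= rho x)%R ->
    (fun x => (u (p x) * rho x)%:E)^\+ = (fun x => (u^\+ (p x) * rho x)%:E)%R.
  move=> r0; apply/funext => x; rewrite funeposE /funrpos/=.
  by rewrite -EFin_max maxr_pMl// mul0r.
have nE X (p : X -> Y) (rho : X -> R) : (forall x, 0 <= rho x)%R ->
    (fun x => (u (p x) * rho x)%:E)^\- = (fun x => (u^\- (p x) * rho x)%:E)%R.
  move=> r0; apply/funext => x; rewrite funenegE /funrneg/=.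
  by rewrite -EFin_max maxr_pMl// mul0r mulNr.
rewrite !pE// !nE// !ge0_transfer//.
- exact: measurable_funrneg.
- exact: measurable_funrpos.
Qed.

End transfer.

(** * Expectations under the standard normal law *)

Section normal_expectation.
Context {R : realType}.
Local Notation mu := (@lebesgue_measure R).

Lemma normal_prob_integral (u : R -> R) : measurable_fun setT u ->
  (\int[normal_prob 0 1]_y (u y)%:E = \int[mu]_y (u y * phi y)%:E)%E.
Proof.
move=> mu'; under eq_integral do rewrite -[u _]mulr1.
(* Both maps are the identity; the density is 1 against the normal law and [phi] against Lebesgue
   measure. *)
have H := @transfer _ _ _ _ _ _ R (normal_prob 0 1) mu (@id R) (@id R) (cst 1) phi.
apply: H => //.
- exact: continuous_measurable_fun continuous_phi.
- by move=> x; exact: phi_ge0.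
- move=> B mB; rewrite (_ : (fun _ => _) = cst 1%E)//.
  by rewrite integral_cst// mul1e.
Qed.

Lemma normal_prob_lip1 (h : R -> R) : (forall x y, `|h x - h y| <= `|x - y|) ->
  (\int[normal_prob 0 1]_y (h y)%:E = (gauss_mean h)%:E)%E.
Proof.
move=> hl; rewrite normal_prob_integral; last first.
  exact: continuous_measurable_fun (lip1_continuous hl).
by rewrite /gauss_mean /Rintegral fineK// integrable_fin_num// integrable_lip1_phi.
Qed.

Lemma EabsZE : @EabsZ R = (\int[mu]_t (`|t| * phi t))%:E.
Proof. by rewrite /EabsZ normal_prob_lip1// => x y; exact: ler_dist_dist. Qed.

End normal_expectation.

(** * Means of integrable functions *)

Section has_mean.
Context d (T : measurableType d) (R : realType) (P : probability T R).
Implicit Types (f g u : T -> R) (v w a : R).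

(** Integrability is bundled with the value because [Rintegral] returns 0 when the integral is
    infinite, so a bare equation would not certify a mean. *)
Definition has_mean f v := P.-integrable setT (EFin \o f) /\ \int[P]_x f x = v.

Lemma has_meanI f : P.-integrable setT (EFin \o f) -> has_mean f (\int[P]_x f x).
Proof. by []. Qed.

Lemma has_mean_add f g v w : has_mean f v -> has_mean g w ->
  has_mean (fun x => f x + g x) (v + w).
Proof.
move=> [fi <-] [gi <-]; split; first exact: integrable_add.
by rewrite RintegralD.
Qed.

Lemma has_mean_sub f g v w : has_mean f v -> has_mean g w ->
  has_mean (fun x => f x - g x) (v - w).
Proof.
move=> [fi <-] [gi <-]; split; first exact: integrable_sub.
by rewrite RintegralB.
Qed.

Lemma has_mean_scale a f v : has_mean f v -> has_mean (fun x => a * f x) (a * v).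
Proof.
move=> [fi <-]; split; first exact: integrable_scale.
by rewrite RintegralZl.
Qed.

Lemma has_mean_ae f g v : measurable_fun setT f -> has_mean g v ->
  {ae P, forall x, f x = g x} -> has_mean f v.
Proof.
move=> mf [gi <-] fg.
have mg := measurable_int _ gi.
have aefg : ae_eq P setT (EFin \o f) (EFin \o g).
  by apply: filterS fg => x e _ /=; rewrite e.
have mf' : measurable_fun setT (EFin \o f) by exact/measurable_EFinP.
split; last by rewrite /Rintegral; congr fine; exact: ae_eq_integral.
apply/integrableP; split => //.
have /integrableP[_] := gi; apply: le_lt_trans; rewrite le_eqVlt.
apply/orP; left; apply/eqP; apply: ae_eq_integral => //.
- exact: measurableT_comp.
- exact: measurableT_comp.
- by apply: filterS aefg => x /(_ I) e _; congr abse.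
Qed.

Lemma has_mean_eq f g v w : has_mean f v -> f =1 g -> v = w -> has_mean g w.
Proof. by move=> + /funext <- <-. Qed.

Lemma has_mean_unique f v w : has_mean f v -> has_mean f w -> v = w.
Proof. by move=> [_ <-] [_ <-]. Qed.

Lemma has_mean_le f g v w : has_mean f v -> has_mean g w ->
  (forall x, `|f x| <= g x) -> `|v| <= w.
Proof.
move=> [fi <-] [gi <-] fg; apply: (le_trans (le_normr_Rintegral _ fi)) => //.
by apply: le_Rintegral => //; exact: integrable_normr.
Qed.

Lemma integrable_mul_bounded u f (c : R) : measurable_fun setT u ->
  (forall x, `|u x| <= c) -> P.-integrable setT (EFin \o f) ->
  P.-integrable setT (EFin \o (fun x => u x * f x)).
Proof.
move=> mu uc fi; apply: (@integrable_le _ _ _ P setT measurableT _ (fun x => c * `|f x|)).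
- apply: measurable_funM => //; apply/measurable_EFinP; exact: measurable_int fi.
- by apply: integrable_scale => //; exact: integrable_normr.
- by move=> x _; rewrite normrM ler_wpM2r.
Qed.

End has_mean.

Section conditional_expectation.
Context d (T : measurableType d) (R : realType) (P : probability T R).
Variables (W Y : {RV P >-> R}) (X : T -> R) (g : R * R -> R).
Hypothesis Xg : is_condexp_pair P W Y X g.
Local Notation pair x := (W x, Y x).

Let mWY : measurable_fun setT (fun x => pair x).
Proof. by apply/measurable_fun_pairP; split. Qed.

Let mg : measurable_fun setT g. Proof. by have [] := Xg. Qed.

Let mgWY : measurable_fun setT (fun x => g (pair x)).
Proof. exact: measurableT_comp mg mWY. Qed.

Let Xi : P.-integrable setT (EFin \o X). Proof. by have [_ []] := Xg. Qed.

Let mX : measurable_fun setT X.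
Proof. by apply/measurable_EFinP; exact: measurable_int Xi. Qed.

Let mpre (B : set (R * R)) : measurable B -> measurable ((fun x => pair x) @^-1` B).
Proof. by move=> mB; rewrite -[_ @^-1` _]setTI; exact: mWY. Qed.

Let XgE (B : set (R * R)) : measurable B ->
  (\int[P]_(x in (fun x => pair x) @^-1` B) (X x)%:E =
   \int[P]_(x in (fun x => pair x) @^-1` B) (g (pair x))%:E)%E.
Proof. by have [_ [_]] := Xg; apply. Qed.

Let mgpos : measurable [set p | 0 <= g p].
Proof.
rewrite (_ : [set p | _] = g @^-1` `[0, +oo[%classic); last first.
  by apply/seteqP; split => x /=; rewrite in_itv/= andbT.
by rewrite -[_ @^-1` _]setTI; exact: mg.
Qed.

(* [|g| = sgn(g) g], and the sign of [g] is a function of the conditioning pair. *)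
Let abs_le (B : set (R * R)) : measurable B ->
  (\int[P]_(x in (fun x => pair x) @^-1` B) `|g (pair x)|%:E <=
   \int[P]_(x in (fun x => pair x) @^-1` B) `|X x|%:E)%E.
Proof.
move=> mB; pose C := [set p | 0 <= g p].
have mabs (f : T -> R) (A : set T) : measurable_fun setT f ->
    measurable_fun A (fun x => `|f x|%:E).
  move=> mf; apply: measurable_funTS; apply/measurable_EFinP.
  exact: measurableT_comp.
have -> : B = (B `&` C) `|` (B `&` ~` C) by rewrite -setIUr setUv setIT.
rewrite preimage_setU.
have dj : [disjoint (fun x => pair x) @^-1` (B `&` C) &
    (fun x => pair x) @^-1` (B `&` ~` C)].
  by apply/disj_setPS => x [/= [_ ?] [_]].
have mB1 : measurable (B `&` C) by exact: measurableI.
have mB2 : measurable (B `&` ~` C) by apply: measurableI => //; exact: measurableC.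
rewrite !ge0_integral_setU//=; try exact: mpre; try exact: mabs.
have abs_int (A : set (R * R)) : measurable A ->
    (`| \int[P]_(x in (fun x => pair x) @^-1` A) (X x)%:E | <=
     \int[P]_(x in (fun x => pair x) @^-1` A) `|X x|%:E)%E.
  move=> mA; apply: le_abse_integral; first exact: mpre.
  by apply: measurable_funTS; exact/measurable_EFinP.
apply: leeD.
- apply: le_trans (abs_int _ mB1); rewrite XgE//.
  rewrite (eq_integral (fun x => (g (pair x))%:E)); first exact: lee_abs.
  by move=> x /set_mem[_ /= gx]; rewrite ger0_norm.
- apply: le_trans (abs_int _ mB2); rewrite XgE//.
  rewrite [in leRHS](eq_integral (fun x => - `|g (pair x)|%:E)%E); last first.
    move=> x /set_mem[_ /= /negP]; rewrite -ltNge => gx.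
    by rewrite ltr0_norm//= opprK.
  rewrite integral_ge0N; first by rewrite abseN; exact: lee_abs.
  by move=> x _; rewrite lee_fin.
Qed.

(** [is_condexp_pair] states integrability of [X] only. That of [u * g] is deduced by comparing
    [|g|] with [|X|] on every event determined by the pair; [u = 1] gives the integrability of
    [g (W, Y)]. *)
Let condexp_integrable (u : R * R -> R) : measurable_fun setT u ->
  P.-integrable setT (EFin \o (fun x => u (pair x) * X x)) ->
  P.-integrable setT (EFin \o (fun x => u (pair x) * g (pair x))).
Proof.
move=> mu uXi; apply/integrableP; split.
  apply/measurable_EFinP; apply: measurable_funM => //.
  exact: measurableT_comp mu mWY.
have /integrableP[_] := uXi; apply: le_lt_trans.
under eq_integral do rewrite /= normrM.
under [leRHS]eq_integral do rewrite /= normrM.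
apply: (@le_transfer _ _ _ _ _ _ R P P (fun x => pair x) (fun x => pair x)
  (fun x => `|g (pair x)|) (fun x => `|X x|) mWY mWY _ _ _ _ (fun p => `|u p|)) => //.
- exact: measurableT_comp.
- exact: measurableT_comp.
- exact: measurableT_comp.
Qed.

(* Adding [|X| + |g|] to both [X] and [g] makes them nonnegative. *)
Lemma condexp_mul (u : R * R -> R) : measurable_fun setT u ->
  P.-integrable setT (EFin \o (fun x => u (pair x) * X x)) ->
  P.-integrable setT (EFin \o (fun x => u (pair x) * g (pair x))) /\
  \int[P]_x (u (pair x) * X x) = \int[P]_x (u (pair x) * g (pair x)).
Proof.
move=> mu uXi; have ugi := condexp_integrable mu uXi; split => //.
have muWY : measurable_fun setT (fun x => u (pair x)) by exact: measurableT_comp mu mWY.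
have gi : P.-integrable setT (EFin \o (fun x => g (pair x))).
  have := @condexp_integrable (cst 1); rewrite /cst.
  rewrite (_ : (fun x => 1 * X x) = X); last by apply/funext => x; rewrite mul1r.
  rewrite (_ : (fun x => 1 * g (pair x)) = fun x => g (pair x)); last first.
    by apply/funext => x; rewrite mul1r.
  by apply.
pose s x : R := `|X x| + `|g (pair x)|.
have si : P.-integrable setT (EFin \o s).
  by apply: integrable_add => //; exact: integrable_normr.
have ms : measurable_fun setT s.
  by apply: measurable_funD; exact: measurableT_comp.
have [s0 s1] : (forall x, 0 <= s x + X x) /\ (forall x, 0 <= s x + g (pair x)).
  split => x; rewrite /s.
    by have := ler_norm (- X x); rewrite normrN; have := normr_ge0 (g (pair x)); lra.
  by have := ler_norm (- g (pair x)); rewrite normrN; have := normr_ge0 (X x); lra.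
have usi : P.-integrable setT (EFin \o (fun x => u (pair x) * s x)).
  apply: (@integrable_le _ _ _ P setT measurableT _
    (fun x => `|u (pair x) * X x| + `|u (pair x) * g (pair x)|)).
  - exact: measurable_funM.
  - by apply: integrable_add => //; exact: integrable_normr.
  - by move=> x _; rewrite !normrM -mulrDr ler_wpM2l// ger0_norm// addr_ge0.
have E : (\int[P]_x (u (pair x) * (s x + X x))%:E =
          \int[P]_x (u (pair x) * (s x + g (pair x)))%:E)%E.
  apply: (@transfer _ _ _ _ _ _ R P P (fun x => pair x) (fun x => pair x)
    (fun x => s x + X x) (fun x => s x + g (pair x)) mWY mWY) => //.
  - exact: measurable_funD.
  - exact: measurable_funD.
  - move=> B /[dup] mB /mpre mB'.
    under eq_integral do rewrite EFinD.
    under [RHS]eq_integral do rewrite EFinD.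
    have iB f : P.-integrable setT f ->
        P.-integrable ((fun x => pair x) @^-1` B) f by exact: integrableS.
    rewrite !integralD_EFin ?XgE//; do ?[exact: iB|by apply: iB; exact: integrable_normr].
have H1 := has_mean_add (has_meanI usi) (has_meanI uXi).
have H2 := has_mean_add (has_meanI usi) (has_meanI ugi).
apply: (addrI (\int[P]_x (u (pair x) * s x))).
apply: (has_mean_unique H1); apply: (has_mean_eq (f := fun x => u (pair x) * (s x + X x))).
- split; last by rewrite /Rintegral E; reflexivity.
  rewrite (_ : (fun x => _) = fun x => u (pair x) * s x + u (pair x) * X x).
    by case: H1.
  by apply/funext => x; rewrite mulrDr.
- by move=> x; rewrite mulrDr.
- case: H2 => _ <-; rewrite /Rintegral; congr fine; apply: eq_integral => x _.
  by rewrite mulrDr.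
Qed.

End conditional_expectation.

Section exchange.
Context d (T : measurableType d) (R : realType) (P : probability T R).
Variables (W Y W' Y' : {RV P >-> R}).
Hypothesis hexch : forall B : set ((R * R) * (R * R)), measurable B ->
  P ((fun x => ((W x, Y x), (W' x, Y' x))) @^-1` B) =
  P ((fun x => ((W' x, Y' x), (W x, Y x))) @^-1` B).

Lemma exchange (F : (R * R) * (R * R) -> R) : measurable_fun setT F ->
  (\int[P]_x (F ((W x, Y x), (W' x, Y' x)))%:E =
   \int[P]_x (F ((W' x, Y' x), (W x, Y x)))%:E)%E.
Proof.
move=> mF.
have m1 : measurable_fun setT (fun x => ((W x, Y x), (W' x, Y' x))).
  by apply/measurable_fun_pairP; split; apply/measurable_fun_pairP; split.
have m2 : measurable_fun setT (fun x => ((W' x, Y' x), (W x, Y x))).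
  by apply/measurable_fun_pairP; split; apply/measurable_fun_pairP; split.
under eq_integral do rewrite -[F _]mulr1.
under [RHS]eq_integral do rewrite -[F _]mulr1.
apply: (@transfer _ _ _ _ _ _ R P P _ _ (cst 1) (cst 1) m1 m2) => //.
move=> B mB; rewrite (_ : (fun _ => _) = cst 1%E)//.
rewrite !integral_cst ?mul1e//; first exact: hexch.
- by rewrite -[_ @^-1` _]setTI; exact: m2.
- by rewrite -[_ @^-1` _]setTI; exact: m1.
Qed.

Lemma exchange_has_mean (F : (R * R) * (R * R) -> R) v : measurable_fun setT F ->
  has_mean P (fun x => F ((W x, Y x), (W' x, Y' x))) v ->
  has_mean P (fun x => F ((W' x, Y' x), (W x, Y x))) v.
Proof.
move=> mF [/integrableP[_ Fi] <-].
have m2 : measurable_fun setT (fun x => ((W' x, Y' x), (W x, Y x))).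
  by apply/measurable_fun_pairP; split; apply/measurable_fun_pairP; split.
split; last by rewrite /Rintegral exchange.
apply/integrableP; split; first by apply/measurable_EFinP; exact: measurableT_comp mF m2.
move: Fi; rewrite /= (@exchange (fun p => `|F p|))//.
exact: measurableT_comp.
Qed.

End exchange.

(** * Exchangeable pairs *)

Section exchangeable_pair.
Context d (T : measurableType d) (R : realType) (P : probability T R).
Variables (W Y W' Y' : {RV P >-> R}).
Local Notation at_ kap x := ((Y x == kap)%:R : R).
Local Notation jump s x := ((Y' x - Y x == s)%:R : R).
Local Notation dW x := (W' x - W x).

Lemma measurable_eqr (c : R) : measurable_fun setT (fun y : R => (y == c)%:R : R).
Proof.
rewrite (_ : (fun _ => _) = \1_[set c]); first exact: measurable_indic.
by apply/funext => y; rewrite indicE; case: eqP => yc;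
  [rewrite mem_set|rewrite memNset].
Qed.

Let m_at kap : measurable_fun setT (fun x => at_ kap x).
Proof. by apply: (measurableT_comp (measurable_eqr kap)); exact: measurable_funP. Qed.

Let m_dW : measurable_fun setT (fun x => dW x).
Proof. by apply: measurable_funB; exact: measurable_funP. Qed.

Let m_jump s : measurable_fun setT (fun x => jump s x).
Proof.
by apply: (measurableT_comp (measurable_eqr s)); apply: measurable_funB;
  exact: measurable_funP.
Qed.

Let bool_le1 (b : bool) : `|b%:R : R| <= 1.
Proof. by rewrite normr_nat lern1 leq_b1. Qed.

Let le_jump s x y : `|jump s x * y| <= `|y|.
Proof. by rewrite normrM ler_piMl. Qed.

Let m_at_fst kap (u : R -> R) : measurable_fun setT u ->
  measurable_fun setT (fun p : R * R => (p.2 == kap)%:R * u p.1).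
Proof.
move=> mu; apply: measurable_funM.
  exact: (measurableT_comp (measurable_eqr kap) measurable_snd).
exact: (measurableT_comp mu measurable_fst).
Qed.

Lemma condexp_integrable (X : T -> R) (g : R * R -> R) :
  is_condexp_pair P W Y X g -> P.-integrable setT (EFin \o (fun x => g (W x, Y x))).
Proof.
move=> Xg; have := @condexp_mul _ _ _ _ _ _ _ _ Xg (cst 1); rewrite /cst/=.
rewrite (_ : (fun x => 1 * X x) = X); last by apply/funext => x; rewrite mul1r.
rewrite (_ : (fun x => 1 * g _) = fun x => g (W x, Y x)); last first.
  by apply/funext => x; rewrite mul1r.
by case: Xg => _ [Xi _] => /(_ _ Xi)[|//]; exact: measurable_cst.
Qed.

Section first_order.
Variables (f df ht : R -> R) (c lambda psi : R).
Hypotheses (mf : measurable_fun setT f) (mdf : measurable_fun setT df).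
Hypothesis f_le1 : forall x, `|f x| <= 1.
Hypothesis df_le : forall x, `|df x| <= c.
Hypothesis taylor : forall x y, `|f x - f y - df y * (x - y)| <= (x - y) ^+ 2.
Hypothesis stein : forall x, df x - x * f x = ht x.
Hypotheses (lambda_gt0 : 0 < lambda) (Wi : P.-integrable setT (EFin \o W)).
Variables (s kap : R) (g1 g2 : R * R -> R) (R1 R2 : T -> R) (a b e v : R).
Hypothesis g1E : is_condexp_pair P W Y (fun x => dW x ^+ 1 * jump s x) g1.
Hypothesis g2E : is_condexp_pair P W Y (fun x => dW x ^+ 2 * jump s x) g2.
Hypotheses (mR1 : measurable_fun setT R1) (mR2 : measurable_fun setT R2).
Hypothesis M1 : {ae P, forall x, g1 (W x, Y x) = - lambda * (psi * W x / 2 + R1 x)}.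
Hypothesis M2 : {ae P, forall x, g2 (W x, Y x) = lambda * (psi + R2 x)}.
Hypothesis aE : has_mean P (fun x => at_ kap x * `|R1 x|) a.
Hypothesis bE : has_mean P (fun x => at_ kap x * `|R2 x|) b.
Hypothesis eE : has_mean P (fun x => at_ kap x * `|dW x| ^+ 3) e.
Hypothesis vE : has_mean P (fun x => at_ kap x * ht (W x)) v.

Let mW : measurable_fun setT W. Proof. exact: measurable_funP. Qed.
Let mW' : measurable_fun setT W'. Proof. exact: measurable_funP. Qed.

Let mfW : measurable_fun setT (fun x => f (W x)).
Proof. exact: measurableT_comp mf mW. Qed.

Let mdfW : measurable_fun setT (fun x => df (W x)).
Proof. exact: measurableT_comp mdf mW. Qed.

Let X1i : P.-integrable setT (EFin \o (fun x => dW x ^+ 1 * jump s x)).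
Proof. by case: g1E => _ []. Qed.

Let X2i : P.-integrable setT (EFin \o (fun x => dW x ^+ 2 * jump s x)).
Proof. by case: g2E => _ []. Qed.

Let at_mul_le1 u x : `|u| <= 1 -> `|at_ kap x * u| <= 1.
Proof.
move=> u1; rewrite normrM -[leRHS]mulr1; apply: ler_pM => //.
Qed.

Let at_mul_lec u x : `|u| <= c -> `|at_ kap x * u| <= c.
Proof.
by move=> uc; rewrite normrM -[leRHS]mul1r; apply: ler_pM.
Qed.

(** By [M1] the remainder is almost surely a linear combination of [g1 (W, Y)] and [W], both
    integrable. *)
Lemma remainder1_integrable : P.-integrable setT (EFin \o R1).
Proof.
have H := has_mean_sub (has_mean_scale (- lambda^-1) (has_meanI (condexp_integrable g1E)))
  (has_mean_scale (psi / 2) (has_meanI Wi)).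
have [] // := has_mean_ae mR1 H.
apply: filterS M1 => x e1; rewrite e1; field.
by rewrite gt_eqF.
Qed.

Lemma remainder2_integrable : P.-integrable setT (EFin \o R2).
Proof.
have c1 : P.-integrable setT (EFin \o (fun _ : T => psi)).
  by apply: finite_measure_integrable_cst.
have H := has_mean_sub (has_mean_scale lambda^-1 (has_meanI (condexp_integrable g2E)))
  (has_meanI c1).
have [] // := has_mean_ae mR2 H.
apply: filterS M2 => x e1; rewrite e1; field.
by rewrite gt_eqF.
Qed.

(** [dW * (f W + f W')] splits into [2 * dW * f W], [dW^2 * df W] and a rest of size at most
    [|dW|^3]. Conditioning turns the first two into [- lambda * psi * W * f W] and
    [lambda * psi * df W], which add up to [lambda * psi * ht W] by Stein's equation. The remainders
    are weighted by [2 * lambda * f] and [lambda * df], which explains the constants in front of [a]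
    and [b]. *)
Lemma first_order : exists2 w,
  has_mean P (fun x => at_ kap x * (jump s x * (dW x * (f (W x) + f (W' x))))) w &
  `|w - lambda * psi * v| <= 2 * lambda * a + lambda * c * b + e.
Proof.
have R1i := remainder1_integrable; have R2i := remainder2_integrable.
have iq : P.-integrable setT (EFin \o (fun x => (at_ kap x * f (W x)) * W x)).
  apply: (@integrable_mul_bounded _ _ _ _ _ _ 1) => //; first exact: measurable_funM.
  by move=> x; exact: at_mul_le1.
have ir1 : P.-integrable setT (EFin \o (fun x => (at_ kap x * f (W x)) * R1 x)).
  apply: (@integrable_mul_bounded _ _ _ _ _ _ 1) => //; first exact: measurable_funM.
  by move=> x; exact: at_mul_le1.
have iq' : P.-integrable setT (EFin \o (fun x => (at_ kap x * df (W x)) * 1)).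
  apply: (@integrable_mul_bounded _ _ _ _ _ _ c); first exact: measurable_funM.
    by move=> x; exact: at_mul_lec.
  by apply: finite_measure_integrable_cst.
have ir2 : P.-integrable setT (EFin \o (fun x => (at_ kap x * df (W x)) * R2 x)).
  apply: (@integrable_mul_bounded _ _ _ _ _ _ c) => //; first exact: measurable_funM.
  by move=> x; exact: at_mul_lec.
have := has_meanI iq; have := has_meanI ir1; have := has_meanI iq'; have := has_meanI ir2.
move: (\int[P]_x _) => r2 hr2; move: (\int[P]_x _) => q' hq'.
move: (\int[P]_x _) => r1 hr1; move: (\int[P]_x _) => q hq.
have r1a : `|r1| <= a.
  apply: (has_mean_le hr1 aE) => x; rewrite !normrM ler_wpM2r//.
  by rewrite (ger0_norm (ler0n _ _)) ler_piMr.
have r2b : `|r2| <= c * b.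
  apply: (has_mean_le hr2 (has_mean_scale c bE)) => x; rewrite !normrM mulrA ler_wpM2r//.
  by rewrite (ger0_norm (ler0n _ _)) mulrC ler_wpM2r.
have vq : v = q' - q.
  apply: (has_mean_unique vE); apply: (has_mean_eq (has_mean_sub hq' hq)) => // x.
  by rewrite -stein; ring.
have h1 : has_mean P (fun x => (at_ kap x * f (W x)) * (dW x ^+ 1 * jump s x))
    (- lambda * (psi / 2 * q + r1)).
  have [|_ e1] := condexp_mul g1E (m_at_fst kap mf).
    apply: (@integrable_mul_bounded _ _ _ _ _ _ 1) => //; first exact: measurable_funM.
    by move=> x; exact: at_mul_le1.
  have : has_mean P (fun x => (at_ kap x * f (W x)) * g1 (W x, Y x))
      (- lambda * (psi / 2 * q + r1)).
    apply: (has_mean_ae _ (has_mean_scale (- lambda)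
      (has_mean_add (has_mean_scale (psi / 2) hq) hr1))).
      apply: measurable_funM; first exact: measurable_funM.
      by apply/measurable_EFinP; exact: measurable_int (condexp_integrable g1E).
    by apply: filterS M1 => x eM; rewrite eM; field.
  move=> [_ <-]; split; last exact: e1.
  apply: (@integrable_mul_bounded _ _ _ _ _ _ 1) => //; first exact: measurable_funM.
  by move=> x; exact: at_mul_le1.
have h2 : has_mean P (fun x => (at_ kap x * df (W x)) * (dW x ^+ 2 * jump s x))
    (lambda * (psi * q' + r2)).
  have [|_ e1] := condexp_mul g2E (m_at_fst kap mdf).
    apply: (@integrable_mul_bounded _ _ _ _ _ _ c) => //; first exact: measurable_funM.
    by move=> x; exact: at_mul_lec.
  have : has_mean P (fun x => (at_ kap x * df (W x)) * g2 (W x, Y x))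
      (lambda * (psi * q' + r2)).
    apply: (has_mean_ae _ (has_mean_scale lambda
      (has_mean_add (has_mean_scale psi hq') hr2))).
      apply: measurable_funM; first exact: measurable_funM.
      by apply/measurable_EFinP; exact: measurable_int (condexp_integrable g2E).
    by apply: filterS M2 => x eM; rewrite eM; ring.
  move=> [_ <-]; split; last exact: e1.
  apply: (@integrable_mul_bounded _ _ _ _ _ _ c) => //; first exact: measurable_funM.
  by move=> x; exact: at_mul_lec.
have rest_le x : `|at_ kap x * (jump s x * (dW x * (f (W' x) - f (W x) - df (W x) * dW x)))| <=
    at_ kap x * `|dW x| ^+ 3.
  rewrite normrM (ger0_norm (ler0n _ _)) ler_wpM2l ?ler0n//.
  rewrite (le_trans (le_jump _ _ _))// normrM exprS ler_wpM2l//.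
  by rewrite real_normK ?num_real.
have irest : P.-integrable setT (EFin \o (fun x =>
    at_ kap x * (jump s x * (dW x * (f (W' x) - f (W x) - df (W x) * dW x))))).
  case: eE => ei _.
  apply: (@integrable_le _ _ _ P setT measurableT _ _ _ ei) => [|x _]; last exact: rest_le.
  apply: measurable_funM => //; apply: measurable_funM => //.
  apply: measurable_funM => //; apply: measurable_funB; last exact: measurable_funM.
  by apply: measurable_funB => //; exact: measurableT_comp mf mW'.
have := has_meanI irest; move: (\int[P]_x _) => t ht'.
have te : `|t| <= e := has_mean_le ht' eE rest_le.
exists (2 * (- lambda * (psi / 2 * q + r1)) + lambda * (psi * q' + r2) + t).
  apply: (has_mean_eq (has_mean_add (has_mean_add (has_mean_scale 2 h1) h2) ht')) => // x.
  by ring.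
rewrite vq.
have -> : 2 * (- lambda * (psi / 2 * q + r1)) + lambda * (psi * q' + r2) + t
   - lambda * psi * (q' - q) = - (2 * lambda * r1) + lambda * r2 + t by field.
rewrite (le_trans (ler_normD _ _))// lerD//.
rewrite (le_trans (ler_normD _ _))// normrN !normrM (gtr0_norm lambda_gt0) normr_nat.
by rewrite lerD// -?mulrA ler_pM2l// ler_pM2l.
Qed.

End first_order.

Section zeroth_order.
Variables (ht : R -> R) (m Q : R).
Hypothesis mht : measurable_fun setT ht.
Hypothesis ht_le : forall x, `|ht x| <= `|x| + m.
Hypotheses (m_ge0 : 0 <= m) (Wi : P.-integrable setT (EFin \o W)).
Variables (s kap : R) (g0 : R * R -> R) (R0 : T -> R) (cc v : R).
Hypothesis g0E : is_condexp_pair P W Y (fun x => dW x ^+ 0 * jump s x) g0.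
Hypothesis mR0 : measurable_fun setT R0.
Hypothesis M0 : {ae P, forall x, g0 (W x, Y x) = Q + R0 x}.

Let mW : measurable_fun setT W. Proof. exact: measurable_funP. Qed.

Let Wmi : P.-integrable setT (EFin \o (fun x => `|W x| + m)).
Proof.
apply: integrable_add => //; first exact: integrable_normr.
exact: finite_measure_integrable_cst.
Qed.

Let mWm : measurable_fun setT (fun x => `|W x| + m).
Proof. by apply: measurable_funD => //; exact: measurableT_comp. Qed.

Let mug : measurable_fun setT (fun x => g0 (W x, Y x)).
Proof. by apply/measurable_EFinP; exact: measurable_int (condexp_integrable g0E). Qed.

(** The jump indicator is at most 1, so its product with [|W| + m] is integrable; the weight passes
    to [g0], and [M0] identifies [g0 - Q] with [R0]. *)
Lemma remainder0_integrable :
  P.-integrable setT (EFin \o (fun x => (`|W x| + m) * `|R0 x|)).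
Proof.
pose u (p : R * R) : R := `|p.1| + m.
have mu : measurable_fun setT u.
  apply: measurable_funD; last exact: measurable_cst.
  by apply: measurableT_comp => //; exact: measurable_fst.
have [|ug _] := condexp_mul g0E mu.
  apply: (@integrable_le _ _ _ P setT measurableT _ _ _ Wmi) => [|x _].
    by apply: measurable_funM => //; apply: measurable_funM.
  by rewrite expr0 mul1r mulrC (le_trans (le_jump _ _ _))// ger0_norm// addr_ge0.
have mWR : measurable_fun setT (fun x => (`|W x| + m) * R0 x) by exact: measurable_funM.
have hug := has_mean_sub (has_meanI ug) (has_mean_scale Q (has_meanI Wmi)).
have [|i _] := has_mean_ae mWR hug.
  by apply: filterS M0 => x eM; rewrite eM /u/=; ring.
have := integrable_normr i.
rewrite (_ : (fun x : T => `|(`|W x| + m) * R0 x|) =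
             fun x => (`|W x| + m) * `|R0 x|)//.
by apply/funext => x; rewrite normrM ger0_norm// addr_ge0.
Qed.

Hypothesis ccE : has_mean P (fun x => at_ kap x * ((`|W x| + m) * `|R0 x|)) cc.
Hypothesis vE : has_mean P (fun x => at_ kap x * ht (W x)) v.

(** Conditioning on the pair replaces the jump indicator by [Q + R0]; the growth bound on [ht]
    controls the [R0] part. *)
Lemma zeroth_order : exists2 w,
  has_mean P (fun x => at_ kap x * (jump s x * ht (W x))) w & `|w - Q * v| <= cc.
Proof.
have mhtW : measurable_fun setT (fun x => ht (W x)) by exact: measurableT_comp mht mW.
have iuX : P.-integrable setT
    (EFin \o (fun x => at_ kap x * ht (W x) * (dW x ^+ 0 * jump s x))).
  case: vE => vi _.
  apply: (@integrable_le _ _ _ P setT measurableT _ _ _ (integrable_normr vi)).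
    by apply: measurable_funM => //; apply: measurable_funM.
  by move=> x _; rewrite expr0 mul1r mulrC le_jump.
have [ug e1] := condexp_mul g0E (m_at_fst kap mht) iuX.
have := has_meanI ug; rewrite -e1; have := has_meanI iuX.
move: (\int[P]_x _) => w hX hg; exists w.
  by apply: (has_mean_eq hX) => // x; rewrite expr0; ring.
have hr : has_mean P (fun x => at_ kap x * ht (W x) * R0 x) (w - Q * v).
  apply: (has_mean_ae _ (has_mean_sub hg (has_mean_scale Q vE))).
    by apply: measurable_funM => //; apply: measurable_funM.
  by apply: filterS M0 => x eM; rewrite eM; ring.
apply: (has_mean_le hr ccE) => x.
rewrite !normrM (ger0_norm (ler0n _ _)) -mulrA ler_wpM2l ?ler0n//.
by rewrite ler_wpM2r.
Qed.

End zeroth_order.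

End exchangeable_pair.

(** * The bound for one test function *)

Section conditional_bound.
Context d (T : measurableType d) (R : realType) (P : probability T R).
Variables (W Y W' Y' : {RV P >-> R}).
Local Notation at_ kap x := ((Y x == kap)%:R : R).
Local Notation jump s x := ((Y' x - Y x == s)%:R : R).
Local Notation dW x := (W' x - W x).
Local Notation normal_abs_mean := (\int[@lebesgue_measure R]_t (`|t| * phi t)).
Hypothesis hexch : forall B : set ((R * R) * (R * R)), measurable B ->
  P ((fun x => ((W x, Y x), (W' x, Y' x))) @^-1` B) =
  P ((fun x => ((W' x, Y' x), (W x, Y x))) @^-1` B).

Let mW : measurable_fun setT W. Proof. exact: measurable_funP. Qed.
Let mW' : measurable_fun setT W'. Proof. exact: measurable_funP. Qed.

Let m_at kap : measurable_fun setT (fun x => at_ kap x).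
Proof. by apply: (measurableT_comp (measurable_eqr kap)); exact: measurable_funP. Qed.

Lemma integrable_at kap (f : T -> R) : P.-integrable setT (EFin \o f) ->
  P.-integrable setT (EFin \o (fun x => at_ kap x * f x)).
Proof.
apply: (@integrable_mul_bounded _ _ _ _ _ _ 1) => // x.
by rewrite normr_nat lern1 leq_b1.
Qed.

(** A downward jump from [k], seen with the two copies exchanged, is an upward jump from [k - 1]. *)
Let swap_indicator (k y y' : R) :
  (y' == k)%:R * (y - y' == -1)%:R = (y == k - 1)%:R * (y' - y == 1)%:R :> R.
Proof.
rewrite -!natrM !mulnb; congr ((nat_of_bool _)%:R).
by apply/andP/andP => -[/eqP e1 /eqP e2]; split; apply/eqP; move: e1 e2; lra.
Qed.

Let m_swap (k : R) (G : R * R -> R) : measurable_fun setT G ->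
  measurable_fun setT (fun p : (R * R) * (R * R) =>
    (p.1.2 == k)%:R * ((p.2.2 - p.1.2 == -1)%:R * G (p.1.1, p.2.1))).
Proof.
move=> mG.
have m11 : measurable_fun setT (fun p : (R * R) * (R * R) => p.1.1).
  exact: (measurableT_comp measurable_fst measurable_fst).
have m12 : measurable_fun setT (fun p : (R * R) * (R * R) => p.1.2).
  exact: (measurableT_comp measurable_snd measurable_fst).
have m21 : measurable_fun setT (fun p : (R * R) * (R * R) => p.2.1).
  exact: (measurableT_comp measurable_fst measurable_snd).
have m22 : measurable_fun setT (fun p : (R * R) * (R * R) => p.2.2).
  exact: (measurableT_comp measurable_snd measurable_snd).
apply: measurable_funM; first exact: (measurableT_comp (measurable_eqr k) m12).
apply: measurable_funM.
  by apply: (measurableT_comp (measurable_eqr (-1))); exact: measurable_funB.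
by apply: (measurableT_comp mG); apply/measurable_fun_pairP; split.
Qed.

Lemma exchange_jump (k : R) (G : R * R -> R) v : measurable_fun setT G ->
  has_mean P (fun x => at_ k x * (jump (-1) x * G (W x, W' x))) v ->
  has_mean P (fun x => at_ (k - 1) x * (jump 1 x * G (W' x, W x))) v.
Proof.
move=> mG /(exchange_has_mean hexch (m_swap k mG)) H.
by apply: (has_mean_eq H) => // x; rewrite /= !mulrA swap_indicator.
Qed.

Variables (lambda psi Q k : R).
Hypotheses (lambda_gt0 : 0 < lambda) (psi_gt0 : 0 < psi) (Q_gt0 : 0 < Q).
Hypothesis Wi : P.-integrable setT (EFin \o W).

Lemma integrable_W' : P.-integrable setT (EFin \o W').
Proof.
have m11 : measurable_fun setT (fun p : (R * R) * (R * R) => p.1.1).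
  exact: (measurableT_comp measurable_fst measurable_fst).
by have [] := exchange_has_mean hexch m11 (has_meanI Wi).
Qed.

Lemma integrable_dW : P.-integrable setT (EFin \o (fun x => dW x)).
Proof. by apply: integrable_sub => //; exact: integrable_W'. Qed.

Variables (g0p g0m g1p g1m g2p g2m : R * R -> R) (R0p R0m R1p R1m R2p R2m : T -> R).
Hypotheses (mR0p : measurable_fun setT R0p) (mR0m : measurable_fun setT R0m).
Hypotheses (mR1p : measurable_fun setT R1p) (mR1m : measurable_fun setT R1m).
Hypotheses (mR2p : measurable_fun setT R2p) (mR2m : measurable_fun setT R2m).
Hypothesis hg0p : is_condexp_pair P W Y (fun x => dW x ^+ 0 * jump 1 x) g0p.
Hypothesis hg0m : is_condexp_pair P W Y (fun x => dW x ^+ 0 * jump (-1) x) g0m.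
Hypothesis hg1p : is_condexp_pair P W Y (fun x => dW x ^+ 1 * jump 1 x) g1p.
Hypothesis hg1m : is_condexp_pair P W Y (fun x => dW x ^+ 1 * jump (-1) x) g1m.
Hypothesis hg2p : is_condexp_pair P W Y (fun x => dW x ^+ 2 * jump 1 x) g2p.
Hypothesis hg2m : is_condexp_pair P W Y (fun x => dW x ^+ 2 * jump (-1) x) g2m.
Hypothesis hM0p : {ae P, forall x, g0p (W x, Y x) = Q + R0p x}.
Hypothesis hM0m : {ae P, forall x, g0m (W x, Y x) = Q + R0m x}.
Hypothesis hM1p : {ae P, forall x, g1p (W x, Y x) = - lambda * (psi * W x / 2 + R1p x)}.
Hypothesis hM1m : {ae P, forall x, g1m (W x, Y x) = - lambda * (psi * W x / 2 + R1m x)}.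
Hypothesis hM2p : {ae P, forall x, g2p (W x, Y x) = lambda * (psi + R2p x)}.
Hypothesis hM2m : {ae P, forall x, g2m (W x, Y x) = lambda * (psi + R2m x)}.

Variable h : R -> R.
Hypothesis h_lip : forall x y, `|h x - h y| <= `|x - y|.
Local Notation ht w := (h w - gauss_mean h).
Variables (a1 a2 b1 b2 c1 c2 dd e1 e2 v : R).
Hypothesis a1E : has_mean P (fun x => at_ k x * `|R1m x|) a1.
Hypothesis a2E : has_mean P (fun x => at_ (k - 1) x * `|R1p x|) a2.
Hypothesis b1E : has_mean P (fun x => at_ k x * `|R2m x|) b1.
Hypothesis b2E : has_mean P (fun x => at_ (k - 1) x * `|R2p x|) b2.
Hypothesis c1E : has_mean P
  (fun x => at_ k x * ((`|W x| + normal_abs_mean) * `|R0m x|)) c1.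
Hypothesis c2E : has_mean P
  (fun x => at_ (k - 1) x * ((`|W x| + normal_abs_mean) * `|R0p x|)) c2.
Hypothesis ddE : has_mean P (fun x => at_ k x * `|dW x|) dd.
Hypothesis e1E : has_mean P (fun x => at_ k x * `|dW x| ^+ 3) e1.
Hypothesis e2E : has_mean P (fun x => at_ (k - 1) x * `|dW x| ^+ 3) e2.
Hypothesis vE : has_mean P (fun x => at_ k x * ht (W x)) v.

(** Multiplied by [lambda * psi], the means [v] and [v'] on the two levels are approximated by [wm]
    and [wp], which cancel; multiplied by [Q], by [zm] and [zp], which differ by at most [dd]. This
    controls [v + v'] and [v - v']. *)
Lemma conditional_mean_bound : `|v| <=
  psi^-1 * (a1 + a2) + phi 0 / psi * (b1 + b2) +
  (2 * Q)^-1 * (c1 + c2 + dd) + (2 * lambda * psi)^-1 * (e1 + e2).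
Proof.
have [f [df [fdf stein f_le1 df_le taylor]]] := stein_solution h_lip.
have mh : measurable_fun setT h by exact: continuous_measurable_fun (lip1_continuous h_lip).
have mht : measurable_fun setT (fun w => ht w) by exact: measurable_funB.
have mf : measurable_fun setT f by exact: continuous_measurable_fun (derive_continuous fdf).
have mdf : measurable_fun setT df.
  rewrite (_ : df = fun x => ht x + x * f x); last first.
    by apply/funext => x; rewrite -stein subrK.
  by apply: measurable_funD => //; apply: measurable_funM.
have mhtW (V : T -> R) : measurable_fun setT V -> measurable_fun setT (fun x => ht (V x)).
  by move=> mV; exact: measurableT_comp mht mV.
have m_ge0 : 0 <= normal_abs_mean.
  by apply: Rintegral_ge0 => t _; rewrite mulr_ge0// phi_ge0.
have ht_le x : `|ht x| <= `|x| + normal_abs_mean by exact: gauss_mean_dist.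
have hti : P.-integrable setT (EFin \o (fun x => ht (W x))).
  apply: (@integrable_le _ _ _ P setT measurableT _ (fun x => `|W x| + normal_abs_mean)).
  - exact: mhtW.
  - apply: integrable_add => //; first exact: integrable_normr.
    exact: finite_measure_integrable_cst.
  - by move=> x _; exact: ht_le.
have v'E := has_meanI (integrable_at (k - 1) hti).
move: (\int[P]_x _) v'E => v' v'E.
have [wm wmE wm_le] := first_order mf mdf f_le1 df_le taylor stein lambda_gt0 Wi
  hg1m hg2m mR1m mR2m hM1m hM2m a1E b1E e1E vE.
have [wp wpE wp_le] := first_order mf mdf f_le1 df_le taylor stein lambda_gt0 Wi
  hg1p hg2p mR1p mR2p hM1p hM2p a2E b2E e2E v'E.
have [zm zmE zm_le] := zeroth_order mht ht_le hg0m mR0m hM0m c1E vE.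
have [zp zpE zp_le] := zeroth_order mht ht_le hg0p mR0p hM0p c2E v'E.
(* The integrand is antisymmetric in [(W, W')], so exchanging the copies flips its sign while moving
   the jump to the other level. *)
have wpm : wp = - wm.
  have mG : measurable_fun setT (fun p : R * R => (p.2 - p.1) * (f p.1 + f p.2)).
    by apply: measurable_funM; [apply: measurable_funB|apply: measurable_funD];
      do ?[exact: measurable_fst|exact: measurable_snd|
           exact: (measurableT_comp mf measurable_fst)|
           exact: (measurableT_comp mf measurable_snd)].
  have H := has_mean_scale (-1) (exchange_jump mG wmE).
  apply: (has_mean_unique wpE); apply: (has_mean_eq H); last by rewrite mulN1r.
  by move=> x /=; ring.
have mjump : measurable_fun setT (fun x => jump (-1) x).
  by apply: (measurableT_comp (measurable_eqr (-1))); apply: measurable_funB;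
    exact: measurable_funP.
have rest_le x : `|at_ k x * (jump (-1) x * (ht (W' x) - ht (W x)))| <= at_ k x * `|dW x|.
  rewrite !normrM !normr_nat ler_wpM2l ?ler0n//.
  apply: (@le_trans _ _ `|ht (W' x) - ht (W x)|).
    by rewrite ler_piMl ?lern1 ?leq_b1.
  by rewrite opprB addrA subrK h_lip.
have resti : P.-integrable setT
    (EFin \o (fun x => at_ k x * (jump (-1) x * (ht (W' x) - ht (W x))))).
  case: ddE => di _.
  apply: (@integrable_le _ _ _ P setT measurableT _ _ _ di) => [|x _]; last exact: rest_le.
  apply: measurable_funM => //; apply: measurable_funM => //.
  by apply: measurable_funB; exact: mhtW.
have := has_meanI resti; move: (\int[P]_x _) => t tE.
have t_le : `|t| <= dd := has_mean_le tE ddE rest_le.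
(* Exchange carries [ht W] on the jumps up from [k - 1] to [ht W'] on the jumps down from [k]; [t]
   is the cost of replacing [W'] by [W] there. *)
have zpm : zp = zm + t.
  have mG : measurable_fun setT (fun p : R * R => ht p.2).
    exact: (measurableT_comp mht measurable_snd).
  have H : has_mean P (fun x => at_ k x * (jump (-1) x * ht (W' x))) (zm + t).
    by apply: (has_mean_eq (has_mean_add zmE tE)) => // x; ring.
  apply: (has_mean_unique zpE).
  exact: (exchange_jump mG H).
have S1 : lambda * psi * `|v + v'| <=
    2 * lambda * (a1 + a2) + lambda * (2 * phi 0) * (b1 + b2) + (e1 + e2).
  rewrite -[lambda * psi]gtr0_norm ?mulr_gt0// -normrM.
  have -> : lambda * psi * (v + v') =
      - ((wm - lambda * psi * v) + (wp - lambda * psi * v')) by rewrite wpm; ring.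
  rewrite normrN (le_trans (ler_normD _ _))//.
  by move: wm_le wp_le; lra.
have S2 : Q * `|v - v'| <= c1 + c2 + dd.
  rewrite -{1}[Q]gtr0_norm// -normrM.
  have -> : Q * (v - v') = - (zm - Q * v) + (zp - Q * v') - t by rewrite zpm; ring.
  rewrite (le_trans (ler_normB _ _))// lerD// (le_trans (ler_normD _ _))//.
  by rewrite normrN lerD.
have lp : 0 < lambda * psi by exact: mulr_gt0.
(* This halving yields 1/(2Q) and 1/(2 lambda psi) and reduces [2 * phi 0] to [phi 0]. *)
have -> : v = ((v + v') + (v - v')) / 2 by field.
rewrite normrM (ger0_norm (_ : 0 <= 2^-1))// ler_pdivrMr//.
rewrite (le_trans (ler_normD _ _))//.
have {}S1 : `|v + v'| <= (2 * lambda * (a1 + a2) + lambda * (2 * phi 0) * (b1 + b2) +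
    (e1 + e2)) / (lambda * psi) by rewrite ler_pdivlMr// mulrC.
have {}S2 : `|v - v'| <= (c1 + c2 + dd) / Q by rewrite ler_pdivlMr// mulrC.
apply: (le_trans (lerD S1 S2)); rewrite le_eqVlt; apply/orP; left; apply/eqP.
by field; rewrite !gt_eqF.
Qed.

End conditional_bound.

(** * Conditioning on one or two values of [Y] *)

Section conditioning_on_atom.
Context d (T : measurableType d) (R : realType) (P : probability T R).
Variable Y : {RV P >-> R}.
Local Notation at_ kap x := ((Y x == kap)%:R : R).

Lemma measurable_atom kap : measurable [set x | Y x = kap].
Proof.
by rewrite -[[set _ | _]]setTI; exact: (measurable_funP Y) (measurable_set1 kap).
Qed.

Lemma integral_atom kap (f : T -> R) :
  (\int[P]_(x in [set x | Y x = kap]) (f x)%:E = \int[P]_x (at_ kap x * f x)%:E)%E.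
Proof.
rewrite integral_mkcond; apply: eq_integral => x _; rewrite patchE.
case: ifPn => [/set_mem/= ->|/negP xk]; first by rewrite eqxx mul1r.
case: eqP => [xk'|_]; last by rewrite mul0r.
by exfalso; apply: xk; rewrite inE.
Qed.

Lemma condE_atom kap (f : T -> R) v : has_mean P (fun x => at_ kap x * f x) v ->
  condE P [set x | Y x = kap] (fun x => (f x)%:E) =
  (v / fine (P [set x | Y x = kap]))%:E.
Proof.
move=> [fi <-]; rewrite /condE integral_atom EFinM /Rintegral fineK//.
exact: integrable_fin_num.
Qed.

Lemma integral_atoms (k k' : R) (f : T -> R) : k' != k -> measurable_fun setT f ->
  (forall x, 0 <= f x) ->
  (\int[P]_(x in [set x | Y x = k' \/ Y x = k]) (f x)%:E =
   \int[P]_x (at_ k' x * f x)%:E + \int[P]_x (at_ k x * f x)%:E)%E.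
Proof.
move=> kk' mf f0; rewrite (_ : [set x | _ \/ _] = [set x | Y x = k'] `|` [set x | Y x = k])//.
rewrite ge0_integral_setU ?integral_atom//; try exact: measurable_atom.
- by apply: measurable_funTS; exact/measurable_EFinP.
- by move=> x _; rewrite lee_fin.
- by apply/disj_setPS => x [/= -> /eqP]; rewrite (negbTE kk').
Qed.

Lemma probability_atoms (k k' : R) : k' != k ->
  fine (P [set x | Y x = k' \/ Y x = k]) =
  fine (P [set x | Y x = k']) + fine (P [set x | Y x = k]).
Proof.
move=> kk'; rewrite (_ : [set x | _ \/ _] = [set x | Y x = k'] `|` [set x | Y x = k])//.
rewrite measureU ?fineD ?fin_num_measure//; try exact: measurable_atom.
apply/seteqP; split => // x [/= -> /eqP]; by rewrite (negbTE kk').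
Qed.

Lemma condE_atoms (k k' : R) (f : T -> R) v v' : k' != k -> measurable_fun setT f ->
  (forall x, 0 <= f x) -> has_mean P (fun x => at_ k x * f x) v ->
  has_mean P (fun x => at_ k' x * f x) v' ->
  condE P [set x | Y x = k' \/ Y x = k] (fun x => (f x)%:E) =
  ((v + v') / (fine (P [set x | Y x = k]) + fine (P [set x | Y x = k'])))%:E.
Proof.
move=> kk' mf f0 [fi <-] [fi' <-]; rewrite /condE integral_atoms//.
rewrite probability_atoms// EFinM EFinD /Rintegral !fineK ?integrable_fin_num//.
by rewrite addeC [X in X^-1]addrC.
Qed.

(** For a nonnegative function, failure of integrability means an infinite integral; the positive
    mass at [k] keeps the normalising factor positive. This disposes of the case of an infinite
    third moment. *)
Lemma condE_atoms_infty (k k' : R) (f : T -> R) : k' != k -> measurable_fun setT f ->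
  (forall x, 0 <= f x) -> (0 < P [set x | Y x = k])%E ->
  ~ (P.-integrable setT (EFin \o (fun x => at_ k x * f x)) /\
     P.-integrable setT (EFin \o (fun x => at_ k' x * f x))) ->
  condE P [set x | Y x = k' \/ Y x = k] (fun x => (f x)%:E) = +oo%E.
Proof.
move=> kk' mf f0 Pk ni; rewrite /condE integral_atoms//.
have m_at kap : measurable_fun setT (fun x => at_ kap x * f x).
  apply: measurable_funM => //.
  by apply: (measurableT_comp (measurable_eqr kap)); exact: measurable_funP.
have at0 kap x : 0 <= at_ kap x * f x by rewrite mulr_ge0.
have ge0 kap : (0 <= \int[P]_x (at_ kap x * f x)%:E)%E.
  by apply: integral_ge0 => x _; rewrite lee_fin.
have fin kap : (\int[P]_x (at_ kap x * f x)%:E < +oo)%E ->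
    P.-integrable setT (EFin \o (fun x => at_ kap x * f x)).
  move=> lt; apply/integrableP; split; first exact/measurable_EFinP.
  by under eq_integral do rewrite /= ger0_norm//.
have -> : (\int[P]_x (at_ k' x * f x)%:E + \int[P]_x (at_ k x * f x)%:E = +oo)%E.
  apply/eqP; rewrite -leye_eq leNgt; apply/negP => lt; apply: ni; split; apply: fin.
    by apply: le_lt_trans lt; rewrite leeDr.
  by apply: le_lt_trans lt; rewrite leeDl.
rewrite probability_atoms// gt0_mulye// lte_fin invr_gt0.
by rewrite ltr_wpDl ?fine_ge0// fine_gt0// Pk ltey_eq fin_num_measure//; exact: measurable_atom.
Qed.

End conditioning_on_atom.

(** * Second moments *)

Lemma second_moment d (T : measurableType d) (R : realType) (P : probability T R)
    (X : {RV P >-> R}) (v : R) : ('E_P[X] = 0)%E -> 'V_P[X] = v%:E ->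
  (\int[P]_x (X x ^+ 2)%:E = v%:E)%E.
Proof.
move=> X0 <-; rewrite /variance covariance.unlock X0 expectation.unlock.
by apply: eq_integral => x _; rewrite !fctE/= !subr0 expr2.
Qed.

Lemma integrable_of_second_moment d (T : measurableType d) (R : realType)
    (P : probability T R) (X : {RV P >-> R}) (v : R) :
  (\int[P]_x (X x ^+ 2)%:E = v%:E)%E -> P.-integrable setT (EFin \o X).
Proof.
move=> X2; have mX : measurable_fun setT X by exact: measurable_funP.
have i2 : P.-integrable setT (EFin \o (fun x => X x ^+ 2)).
  apply/integrableP; split.
    by apply/measurable_EFinP; exact: measurable_funX.
  under eq_integral do rewrite /= ger0_norm ?sqr_ge0//.
  by rewrite X2 ltry.
apply: (@integrable_le _ _ _ P setT measurableT _ (fun x => 1 + X x ^+ 2)) => //.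
  by apply: integrable_add => //; exact: finite_measure_integrable_cst.
move=> x _; rewrite -(real_normK (num_real (X x))).
by move: (normr_ge0 (X x)); nra.
Qed.

(** The atom alone contributes [k^2 * P(Y = k)] to the second moment. This supplies the positivity
    of the variance of [Y], hence of [Q]. *)
Lemma second_moment_gt0 d (T : measurableType d) (R : realType)
    (P : probability T R) (Y : {RV P >-> R}) (v k : R) :
  (\int[P]_x (Y x ^+ 2)%:E = v%:E)%E -> k != 0 ->
  (0 < P [set x | Y x = k])%E -> 0 < v.
Proof.
move=> Y2 k0 Pk; rewrite -lte_fin -Y2.
apply: (@lt_le_trans _ _ (\int[P]_(x in [set x | Y x = k]) (Y x ^+ 2)%:E)%E).
  rewrite (eq_integral (fun _ => (k ^+ 2)%:E)); last by move=> x /set_mem/= ->.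
  rewrite integral_cst; last exact: measurable_atom.
  by rewrite mule_gt0// lte_fin exprn_even_gt0.
apply: ge0_subset_integral => //; first exact: measurable_atom.
  by apply/measurable_EFinP; apply: measurable_funX; exact: measurable_funP.
by move=> x _; rewrite lee_fin sqr_ge0.
Qed.

Unset Implicit Arguments.

Theorem theorem2p4 (d : measure_display) (T : measurableType d) (R : realType)
  (P : probability T R) (W Y W' Y' : {RV P >-> R})
  (sigmaY lambda psi zeta k : R)
  (g0p g0m g1p g1m g2p g2m : R * R -> R)
  (R0p R0m R1p R1m R2p R2m : T -> R)
  (* (I) *)
  (hEW : ('E_P[W] = 0)%E) (hVW : 'V_P[W] = 1%E)
  (hEY : ('E_P[Y] = 0)%E) (hVY : 'V_P[Y] = (sigmaY ^+ 2)%:E)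
  (hcov : covariance P W Y = 0%E)
  (hexch : forall B : set ((R * R) * (R * R)), measurable B ->
     P ((fun x => ((W x, Y x), (W' x, Y' x))) @^-1` B) =
     P ((fun x => ((W' x, Y' x), (W x, Y x))) @^-1` B))
  (* (II) *)
  (hzeta : 0 <= zeta < 1)
  (hYlat : {ae P, forall x, exists z : int, Y x = zeta + z%:~R})
  (hDY : {ae P, forall x, Y' x - Y x = -1 \/ Y' x - Y x = 0 \/ Y' x - Y x = 1})
  (hlambda : 0 < lambda < 1) (hpsi : 0 < psi)
  (hR0p : measurable_fun setT R0p) (hR0m : measurable_fun setT R0m)
  (hR1p : measurable_fun setT R1p) (hR1m : measurable_fun setT R1m)
  (hR2p : measurable_fun setT R2p) (hR2m : measurable_fun setT R2m)
  (* g_{l,+/-} is a version of M_{l,+/-}(W,Y) = E((dW)^l 1{dY = +/-1} | W, Y) *)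
  (hg0p : is_condexp_pair P W Y
     (fun x => (W' x - W x) ^+ 0 * (Y' x - Y x == 1)%:R) g0p)
  (hg0m : is_condexp_pair P W Y
     (fun x => (W' x - W x) ^+ 0 * (Y' x - Y x == -1)%:R) g0m)
  (hg1p : is_condexp_pair P W Y
     (fun x => (W' x - W x) ^+ 1 * (Y' x - Y x == 1)%:R) g1p)
  (hg1m : is_condexp_pair P W Y
     (fun x => (W' x - W x) ^+ 1 * (Y' x - Y x == -1)%:R) g1m)
  (hg2p : is_condexp_pair P W Y
     (fun x => (W' x - W x) ^+ 2 * (Y' x - Y x == 1)%:R) g2p)
  (hg2m : is_condexp_pair P W Y
     (fun x => (W' x - W x) ^+ 2 * (Y' x - Y x == -1)%:R) g2m)
  (hM0p : {ae P, forall x, g0p (W x, Y x) = lambda * sigmaY ^+ 2 + R0p x})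
  (hM0m : {ae P, forall x, g0m (W x, Y x) = lambda * sigmaY ^+ 2 + R0m x})
  (* (III) *)
  (hM1p : {ae P, forall x, g1p (W x, Y x) = - lambda * (psi * W x / 2 + R1p x)})
  (hM1m : {ae P, forall x, g1m (W x, Y x) = - lambda * (psi * W x / 2 + R1m x)})
  (* (IV) *)
  (hM2p : {ae P, forall x, g2p (W x, Y x) = lambda * (psi + R2p x)})
  (hM2m : {ae P, forall x, g2m (W x, Y x) = lambda * (psi + R2m x)})
  (* p_k > 0, p_{k-1} > 0 *)
  (hpk : (0 < P [set x | Y x = k])%E)
  (hpk1 : (0 < P [set x | Y x = (k - 1)%R])%E) :
  let Q := lambda * sigmaY ^+ 2 in
  let Ek := [set x | Y x = k] in
  let Ek1 := [set x | Y x = k - 1] in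
  let Ekk := [set x | Y x = k - 1 \/ Y x = k] in
  let r := fine (P Ek1) / fine (P Ek) in
  let Ahat := (condE P Ek (fun x => (`|R1m x|)%:E)
               + r%:E * condE P Ek1 (fun x => (`|R1p x|)%:E))%E in
  let Bhat := (condE P Ek (fun x => (`|R2m x|)%:E)
               + r%:E * condE P Ek1 (fun x => (`|R2p x|)%:E))%E in
  let Chat := condE P Ekk (fun x => ((`|W x|)%:E + EabsZ)
                                    * (`|R0p x| + `|R0m x|)%R%:E)%E in
  let Dhat := condE P Ekk (fun x => (`|W' x - W x|)%:E) in
  let Ehat := condE P Ekk (fun x => (`|W' x - W x| ^+ 3)%:E) in
  (dW_cond_normal P Ek W <=
     (psi^-1)%:E * Ahat
   + (Num.sqrt (1 / (2 * pi * psi ^+ 2)))%:E * Bhat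
   + (1 + r)%:E * ((1 / (2 * Q))%:E * Chat + (1 / (2 * Q))%:E * Dhat
                   + (2 / (3 * lambda * psi))%:E * Ehat))%E.
Proof.
pose Q := lambda * sigmaY ^+ 2.
pose Ek := [set x | Y x = k]; pose Ek1 := [set x | Y x = k - 1].
pose Ekk := [set x | Y x = k - 1 \/ Y x = k].
pose r := fine (P Ek1) / fine (P Ek).
pose Ahat := (condE P Ek (fun x => (`|R1m x|)%:E)
              + r%:E * condE P Ek1 (fun x => (`|R1p x|)%:E))%E.
pose Bhat := (condE P Ek (fun x => (`|R2m x|)%:E)
              + r%:E * condE P Ek1 (fun x => (`|R2p x|)%:E))%E.
pose Chat := condE P Ekk (fun x => ((`|W x|)%:E + EabsZ)
                                   * (`|R0p x| + `|R0m x|)%R%:E)%E.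
pose Dhat := condE P Ekk (fun x => (`|W' x - W x|)%:E).
pose Ehat := condE P Ekk (fun x => (`|W' x - W x| ^+ 3)%:E).
suff : (dW_cond_normal P Ek W <=
     (psi^-1)%:E * Ahat
   + (Num.sqrt (1 / (2 * pi * psi ^+ 2)))%:E * Bhat
   + (1 + r)%:E * ((1 / (2 * Q))%:E * Chat + (1 / (2 * Q))%:E * Dhat
                   + (2 / (3 * lambda * psi))%:E * Ehat))%E by [].
have lambda_gt0 : 0 < lambda by case/andP: hlambda.
have Wi := integrable_of_second_moment (second_moment hEW hVW).
have kk1 : k - 1 != k by apply/eqP; lra.
have Q_gt0 : 0 < Q.
  apply: mulr_gt0 => //; have Y2 := second_moment hEY hVY.
  (* [k] and [k - 1] are not both zero, and both are atoms of [Y]. *)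
  have [k0|k0] := eqVneq k 0; last exact: second_moment_gt0 Y2 k0 hpk.
  by apply: second_moment_gt0 Y2 _ hpk1; rewrite k0; apply/eqP; lra.
pose m : R := \int[@lebesgue_measure R]_t (`|t| * phi t).
have m_ge0 : 0 <= m by apply: Rintegral_ge0 => t _; rewrite mulr_ge0// phi_ge0.
have fPk : 0 < fine (P Ek).
  by rewrite fine_gt0// hpk ltey_eq fin_num_measure//; exact: measurable_atom.
have fPk1 : 0 < fine (P Ek1).
  by rewrite fine_gt0// hpk1 ltey_eq fin_num_measure//; exact: measurable_atom.
pose pk := fine (P Ek); pose pk1 := fine (P Ek1).
have mW : measurable_fun setT W by exact: measurable_funP.
have mdW : measurable_fun setT (fun x => W' x - W x).
  by apply: measurable_funB; exact: measurable_funP.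
have at_mean kap (f : T -> R) (fi : P.-integrable setT (EFin \o f)) :=
  has_meanI (integrable_at Y kap fi).
have a1E := at_mean k _ (integrable_normr (remainder1_integrable lambda_gt0 Wi hg1m hR1m hM1m)).
have a2E := at_mean (k - 1) _
  (integrable_normr (remainder1_integrable lambda_gt0 Wi hg1p hR1p hM1p)).
have b1E := at_mean k _ (integrable_normr (remainder2_integrable lambda_gt0 hg2m hR2m hM2m)).
have b2E := at_mean (k - 1) _
  (integrable_normr (remainder2_integrable lambda_gt0 hg2p hR2p hM2p)).
have i0m := remainder0_integrable m_ge0 Wi hg0m hR0m hM0m.
have i0p := remainder0_integrable m_ge0 Wi hg0p hR0p hM0p.
(* [Chat] pairs both remainders with both levels. The bound uses only [c1] (downward at [k]) and
   [c2] (upward at [k - 1]); the cross terms [c1'] and [c2'] are nonnegative and absorb the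
   difference. *)
have c1E := at_mean k _ i0m; have c1'E := at_mean k _ i0p.
have c2E := at_mean (k - 1) _ i0p; have c2'E := at_mean (k - 1) _ i0m.
have d1E := at_mean k _ (integrable_normr (integrable_dW hexch Wi)).
have d2E := at_mean (k - 1) _ (integrable_normr (integrable_dW hexch Wi)).
move: (\int[P]_x _) a1E => a1 a1E; move: (\int[P]_x _) a2E => a2 a2E.
move: (\int[P]_x _) b1E => b1 b1E; move: (\int[P]_x _) b2E => b2 b2E.
move: (\int[P]_x _) c1E => c1 c1E; move: (\int[P]_x _) c1'E => c1' c1'E.
move: (\int[P]_x _) c2E => c2 c2E; move: (\int[P]_x _) c2'E => c2' c2'E.
move: (\int[P]_x _) d1E => d1 d1E; move: (\int[P]_x _) d2E => d2 d2E.
have AhatE : Ahat = ((a1 + a2) / pk)%:E.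
  rewrite /Ahat (condE_atom a1E) (condE_atom a2E) -EFinM -EFinD; congr EFin.
  by rewrite /r /pk; field; rewrite !gt_eqF.
have BhatE : Bhat = ((b1 + b2) / pk)%:E.
  rewrite /Bhat (condE_atom b1E) (condE_atom b2E) -EFinM -EFinD; congr EFin.
  by rewrite /r /pk; field; rewrite !gt_eqF.
have ChatE : Chat = ((c1 + c1' + (c2 + c2')) / (pk + pk1))%:E.
  rewrite /Chat EabsZE -/m.
  apply: (@condE_atoms _ _ _ _ _ _ _
    (fun x => (`|W x| + m) * (`|R0p x| + `|R0m x|))) => //.
  - apply: measurable_funM; apply: measurable_funD => //; exact: measurableT_comp.
  - by move=> x; rewrite mulr_ge0// addr_ge0.
  - by apply: (has_mean_eq (has_mean_add c1E c1'E)) => // x; rewrite /m; ring.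
  - by apply: (has_mean_eq (has_mean_add c2E c2'E)) => // x; rewrite /m; ring.
have DhatE : Dhat = ((d1 + d2) / (pk + pk1))%:E.
  apply: condE_atoms => //; exact: measurableT_comp.
have sqrtE : Num.sqrt (1 / (2 * pi * psi ^+ 2)) = phi 0 / psi.
  have pi2 : 0 <= 2 * pi :> R by rewrite mulr_ge0// pi_ge0.
  rewrite div1r sqrtrV; last by rewrite mulr_ge0 ?sqr_ge0.
  by rewrite (sqrtrM _ pi2) sqrtr_sqr gtr0_norm// phi0E invfM.
have r_ge0 : 0 <= r by rewrite divr_ge0 // ltW.
pose coef : R := 2 / (3 * lambda * psi).
have coef_gt0 : 0 < coef by rewrite divr_gt0// !mulr_gt0.
rewrite AhatE BhatE ChatE DhatE sqrtE -/coef.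
pose f3 x := `|W' x - W x| ^+ 3.
have mf3 : measurable_fun setT f3 by apply: measurable_funX; exact: measurableT_comp.
have f3_ge0 x : 0 <= f3 x by rewrite exprn_ge0.
(* If the third moment of the increment is infinite on one of the two levels, then [Ehat] is
   infinite; its coefficient is positive and the other terms are finite, so the bound is trivial. *)
have [[ie1 ie2]|ninf] := pselect
    (P.-integrable setT (EFin \o (fun x => (Y x == k)%:R * f3 x)) /\
     P.-integrable setT (EFin \o (fun x => (Y x == k - 1)%:R * f3 x))); last first.
  rewrite /Ehat (condE_atoms_infty kk1 mf3 f3_ge0 hpk ninf).
  rewrite [X in (_ + X)%E](_ : _ = +oo%E); last first.
    rewrite gt0_muley ?lte_fin// -!EFinM -EFinD addey//.
    by rewrite gt0_muley// lte_fin ltr_pwDl.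
  by rewrite -!EFinM -EFinD addey// leey.
have e1E := has_meanI ie1; have e2E := has_meanI ie2.
move: (\int[P]_x _) e1E => e1 e1E; move: (\int[P]_x _) e2E => e2 e2E.
have EhatE : Ehat = ((e1 + e2) / (pk + pk1))%:E by exact: condE_atoms.
rewrite EhatE -!EFinM -!EFinD.
apply: ub_ereal_sup => _ [h [h_lip ->]].
have hWi : P.-integrable setT (EFin \o (fun x => h (W x))).
  apply: (@integrable_le _ _ _ P setT measurableT _ (fun x => `|h 0| + `|W x|)).
  - apply: measurableT_comp mW.
    exact: continuous_measurable_fun (lip1_continuous h_lip).
  - apply: integrable_add => //; first exact: finite_measure_integrable_cst.
    exact: integrable_normr.
  - move=> x _; have := h_lip (W x) 0; rewrite subr0.
    by have := ler_normD (h 0) (h (W x) - h 0); rewrite addrC subrK; lra.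
have vE := at_mean k _ hWi; move: (\int[P]_x _) vE => vh vhE.
have pkE : has_mean P (fun x => (Y x == k)%:R) pk.
  have i1 : P.-integrable setT (EFin \o (fun _ : T => (1 : R))).
    exact: finite_measure_integrable_cst.
  apply: (has_mean_eq (at_mean k _ i1)) => [x|]; first by rewrite mulr1.
  by rewrite /Rintegral -integral_atom integral_cst ?mul1e//; exact: measurable_atom.
have vE : has_mean P (fun x => (Y x == k)%:R * (h (W x) - gauss_mean h))
    (vh - gauss_mean h * pk).
  by apply: (has_mean_eq (has_mean_sub vhE (has_mean_scale (gauss_mean h) pkE))) => // x; ring.
have bound := conditional_mean_bound hexch lambda_gt0 hpsi Q_gt0 Wi hR0p hR0m hR1p hR1m
  hR2p hR2m hg0p hg0m hg1p hg1m hg2p hg2m hM0p hM0m hM1p hM1m hM2p hM2m h_lip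
  a1E a2E b1E b2E c1E c2E d1E e1E e2E vE.
rewrite (condE_atom vhE) normal_prob_lip1// -EFinB abse_EFin lee_fin -/pk.
have pk_neq0 : pk != 0 by rewrite gt_eqF.
have -> : vh / pk - gauss_mean h = (vh - gauss_mean h * pk) / pk by field.
rewrite normrM normfV (gtr0_norm fPk) ler_pdivrMr//.
have mean_ge0 (f : T -> R) v : (forall x, 0 <= f x) -> has_mean P f v -> 0 <= v.
  by move=> f0 [_ <-]; exact: Rintegral_ge0.
have c1'_ge0 : 0 <= c1' by apply: mean_ge0 c1'E => x; rewrite !mulr_ge0// addr_ge0.
have c2'_ge0 : 0 <= c2' by apply: mean_ge0 c2'E => x; rewrite !mulr_ge0// addr_ge0.
have d2_ge0 : 0 <= d2 by apply: mean_ge0 d2E => x; rewrite mulr_ge0.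
have e1_ge0 : 0 <= e1 by apply: mean_ge0 e1E => x; rewrite mulr_ge0.
have e2_ge0 : 0 <= e2 by apply: mean_ge0 e2E => x; rewrite mulr_ge0.
apply: (le_trans bound).
(* Since [(1 + r) / (pk + pk1) = 1 / pk], multiplying by [pk] removes every conditioning and leaves
   means over the two levels. *)
rewrite [leRHS](_ : _ = psi^-1 * (a1 + a2) + phi 0 / psi * (b1 + b2) +
    (2 * Q)^-1 * (c1 + c1' + (c2 + c2') + (d1 + d2)) + coef * (e1 + e2)); last first.
  rewrite /r /coef -/pk -/pk1; field.
  by rewrite !gt_eqF// addr_gt0.
rewrite lerD//.
  rewrite lerD// ler_wpM2l//; last by lra.
  by rewrite invr_ge0; apply: mulr_ge0 => //; exact: ltW.
rewrite ler_wpM2r ?addr_ge0// /coef.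
(* With [(lambda * psi)^-1] factored out, the comparison of the cubic terms is 1/2 against 2/3. *)
have -> : (2 * lambda * psi)^-1 = (1 / 2) * (lambda * psi)^-1.
  by field; rewrite !gt_eqF.
have -> : 2 / (3 * lambda * psi) = (2 / 3) * (lambda * psi)^-1.
  by field; rewrite !gt_eqF.
rewrite ler_wpM2r ?invr_ge0 ?mulr_ge0 ?(ltW lambda_gt0) ?(ltW hpsi)//.
by lra.
Qed.
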